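(* Let $x_0\in Q$. Then the Cauchy problem $$x'(t)+x(t)=P_Q\big(x(t)-\lambda(t)\nabla f(x(t))\big),\quad t\ge 0,\qquad x(0)=x_0,$$ has a unique global solution $x\in C^1([0,+\infty),\mathcal{H})$ such that $x(t)\in Q$ for all $t\ge 0$. Moreover, if in addition $$\int_0^{+\infty}\lambda(t)\,dt=+\infty\quad\text{and}\quad \int_0^{+\infty}|\lambda'(t)|\,dt<+\infty,$$ then $x(t)$ converges weakly in $\mathcal{H}$ as $t\to+\infty$ to some $x^*\in\arg\min_Q f$, and $$\lim_{t\to+\infty}\Gamma(t)\,\big(f(x(t))-f_Q^*\big)=0,\qquad\text{where } \Gamma(t)=\int_0^t\lambda(s)\,ds .$$
   Context: $\mathcal{H}$ is a real Hilbert space with inner product $\langle\cdot,\cdot\rangle$ and norm $\|\cdot\|$. $Q$ is a closed, convex, non-empty subset of $\mathcal{H}$, and $P_Q:\mathcal{H}\to Q$ is the (metric) projection onto $Q$. $\lambda:[0,+\infty)\to(0,+\infty)$ is an absolutely continuous function belonging to $W^{1,1}_{loc}([0,+\infty))$ (that is, absolutely continuous on each $[0,T]$). $f:\mathcal{H}\to\mathbb{R}$ is a $C^1$ convex function whose gradient $\nabla f$ is locally Lipschitz on $\mathcal{H}$. It is assumed that $f$ attains its minimum over $Q$: with $f_Q^*:=\min_Q f$, the set $\arg\min_Q f:=\{x\in Q: f(x)=f_Q^*\}$ is non-empty. *)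

(* Defs.v *)
From HB Require Import structures.
From mathcomp Require Import all_boot all_order all_algebra.
From mathcomp Require Import all_classical all_reals all_analysis.

Set Implicit Arguments.
Unset Strict Implicit.
Unset Printing Implicit Defensive.

Import Order.TTheory GRing.Theory Num.Theory.
Import numFieldNormedType.Exports.

Local Open Scope classical_set_scope.
Local Open Scope ring_scope.

Definition is_minimum (R : realType) (A : set R) (m : R) : Prop :=
  A m /\ lbound A m.

(* The minimizer exists and is unique when [Q] is closed, convex and nonempty in
   a Hilbert space; [get] returns an arbitrary point when there is none. *)
Definition metric_proj (R : realType) (H : normedModType R) (Q : set H)
    (x : H) : H :=
  get [set p : H | Q p /\ forall y, Q y -> `|x - p| <= `|x - y|].

(* The Riesz representative of the Frechet differential 'd f x. *)
Definition gradient (R : realType) (H : normedModType R)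
    (ip : {dot H for idfun}) (f : H -> R) (x : H) : H :=
  get [set g : H | forall v, 'd f x v = ip g v].

Definition weak_cvg (R : realType) (H : normedModType R) (T : Type)
    (F : set_system T) (u : T -> H) (l : H) : Prop :=
  forall phi : {linear H -> R}, continuous phi -> phi (u t) @[t --> F] --> phi l.

Definition abs_continuous (R : realType) (a b : R) (f : R -> R) : Prop :=
  forall e : R, 0 < e -> exists2 d : R, 0 < d &
    forall (n : nat) (u v : 'I_n -> R),
      (forall i, a <= u i /\ u i <= v i /\ v i <= b) ->
      trivIset setT (fun i => `]u i, v i[%classic) ->
      \sum_(i < n) (v i - u i) < d ->
      \sum_(i < n) `|f (v i) - f (u i)| < e.

Definition derive_quot (R : realType) (V : normedModType R) (x : R -> V)
    (t s : R) : V := (s - t)^-1 *: (x s - x t).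

(* [s] tends to [t] inside [D], so the derivative is one-sided when [t] is an
   end point of an interval [D]; the values of [x] outside [D] are irrelevant. *)
Definition derivable_within (R : realType) (V : normedModType R) (D : set R)
    (x : R -> V) (t : R) : Prop :=
  cvg (derive_quot x t s @[s --> within D t^']).

Definition derive_within (R : realType) (V : normedModType R) (D : set R)
    (x : R -> V) (t : R) : V :=
  lim (derive_quot x t s @[s --> within D t^']).

Definition C1_on (R : realType) (V : normedModType R) (D : set R)
    (x : R -> V) : Prop :=
  (forall t, D t -> derivable_within D x t) /\
  {within D, continuous (derive_within D x)}.

Definition proj_grad_solution (R : realType) (H : normedModType R)
    (ip : {dot H for idfun}) (Q : set H) (f : H -> R) (lambda : R -> R)
    (x0 : H) (x : R -> H) : Prop :=
  [/\ C1_on `[0, +oo[ x,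
      forall t : R, 0 <= t -> derive_within `[0, +oo[ x t + x t =
        metric_proj Q (x t - lambda t *: gradient ip f (x t)) &
      x 0 = x0].

(* Main.v *)
(* The field F(t, u) = P_Q (u - lambda(t) grad f(u)) - u is locally Lipschitz in u.
   Since x' + x lies in Q, the function dist(x, Q) cannot increase and x stays
   in Q. The variational inequality of P_Q at x' + x, tested with x, gives
   |x'|^2 <= - lambda (f o x)', so that |x'| <= c / 2 - lambda (f o x)' / (2 c)
   for every c > 0: a maximal trajectory is Cauchy at a finite end point and can
   be continued.
   Tested with a minimizer z, it gives, with phi = f o x - f_Q^* nonincreasing,
     (|x - z|^2 / 2 + lambda phi)' <= lambda' phi - lambda phi
                                   <= phi(0) |lambda'| - lambda phi.
   With V(t) the variation of lambda on [0, t], which is at most the integral of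
   |lambda'| because lambda is absolutely continuous, the function
   W = |x - z|^2 / 2 + lambda phi - phi(0) V satisfies
   (Gamma q - Gamma p) phi q <= W p - W q for p <= q, and it converges. Letting
   first q and then p go to infinity yields phi -> 0 and Gamma phi -> 0, hence
   also the convergence of |x - z|; Opial's lemma concludes. *)
Require Import Defs.
From HB Require Import structures.
From mathcomp Require Import all_boot all_order all_algebra.
From mathcomp Require Import all_classical all_reals all_analysis.
From mathcomp Require Import ring lra.

Set Implicit Arguments.
Unset Strict Implicit.
Unset Printing Implicit Defensive.

Import Order.TTheory GRing.Theory Num.Theory.
Import numFieldNormedType.Exports.

Local Open Scope classical_set_scope.
Local Open Scope ring_scope.

(** * Hilbert spaces *)

(** Most functions to be shown monotone here are not differentiable: norms of increments, the
    distance to [Q], and [W], since [lambda] has a derivative only almost everywhere. Hence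
    [straddle_nonincreasing], which asks for increments of arbitrarily small slope on both sides of
    each point and never for a derivative; the vector mean value inequality, the invariance of [Q]
    and the Lyapunov estimate all reduce to it. For the same reason [W] carries the variation [V]
    and not the integral of |lambda'|: increments of [lambda] are dominated by those of [V] at every
    pair of points. The derivative of [lambda] enters only in the bound of [V] by that integral,
    through the Jordan decomposition, Radon-Nikodym for the Stieltjes measure of each monotone part,
    and Lebesgue differentiation. The metric projection serves three times: in the dynamics, onto a
    kernel to prove the Riesz theorem (the source of gradients, vector integrals and weak limits),
    and onto a closed ball to make a locally Lipschitz field globally Lipschitz. *)

Section hilbert.
Context (R : realType) (H : completeNormedModType R) (ip : {dot H for idfun}).
Hypothesis ip_norm : forall u : H, `|u| ^+ 2 = ip u u.

Lemma ipC (u v : H) : ip u v = ip v u.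
Proof. by rewrite hermC /= expr0 mul1r. Qed.

Lemma ipDl u v w : ip (u + v) w = ip u w + ip v w.
Proof. exact: linearDl. Qed.

Lemma ipDr u v w : ip u (v + w) = ip u v + ip u w.
Proof. exact: linearDr. Qed.

Lemma ipNl u w : ip (- u) w = - ip u w.
Proof. exact: linearNl. Qed.

Lemma ipNr u w : ip u (- w) = - ip u w.
Proof. exact: linearNr. Qed.

Lemma ipBl u v w : ip (u - v) w = ip u w - ip v w.
Proof. by rewrite ipDl ipNl. Qed.

Lemma ipBr u v w : ip u (v - w) = ip u v - ip u w.
Proof. by rewrite ipDr ipNr. Qed.

Lemma ipZl a u w : ip (a *: u) w = a * ip u w.
Proof. exact: linearZl_LR. Qed.

Lemma ipZr a u w : ip u (a *: w) = a * ip u w.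
Proof. by rewrite ipC ipZl ipC. Qed.

Lemma ip0l w : ip 0 w = 0.
Proof. exact: linear0l. Qed.

Lemma ip0r w : ip w 0 = 0.
Proof. exact: linear0r. Qed.

Lemma normD2 (u v : H) : `|u + v| ^+ 2 = `|u| ^+ 2 + 2 * ip u v + `|v| ^+ 2.
Proof. by rewrite !ip_norm ipDl !ipDr (ipC v u); ring. Qed.

Lemma normB2 (u v : H) : `|u - v| ^+ 2 = `|u| ^+ 2 - 2 * ip u v + `|v| ^+ 2.
Proof. by rewrite normD2 ipNr normrN; ring. Qed.

Lemma ip_cauchy_schwarz (u v : H) : `|ip u v| <= `|u| * `|v|.
Proof.
have [->|v0] := eqVneq v 0; first by rewrite ip0r !normr0 mulr0.
have v_gt0 : 0 < `|v| by rewrite normr_gt0.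
have := sqr_ge0 `|(`|v| ^+ 2) *: u - ip u v *: v|.
rewrite normB2 !normrZ !exprMn ipZl ipZr !real_normK ?num_real// => h.
have h1 : 0 <= `|v| ^+ 2 * ((`|u| * `|v|) ^+ 2 - ip u v ^+ 2).
  by apply: le_trans h _; rewrite le_eqVlt; apply/orP; left; apply/eqP; ring.
rewrite -ler_sqr ?nnegrE ?mulr_ge0// real_normK ?num_real//.
by rewrite pmulr_rge0 ?exprn_gt0// subr_ge0 in h1.
Qed.

Lemma ip_le_norm (u v : H) : ip u v <= `|u| * `|v|.
Proof. exact: le_trans (ler_norm _) (ip_cauchy_schwarz u v). Qed.

Lemma ip_injl (u v : H) : (forall w, ip u w = ip v w) -> u = v.
Proof.
move=> uv; apply/eqP; rewrite -subr_eq0 -normr_eq0 -sqrf_eq0 ip_norm.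
by rewrite ipBl uv subrr.
Qed.

Lemma ip_cvgl (T : Type) (F : set_system T) (FF : Filter F) (u : T -> H) l w :
  u t @[t --> F] --> l -> ip (u t) w @[t --> F] --> ip l w.
Proof.
move=> /cvgrPdist_lt ul; apply/cvgrPdist_lt => e e0.
have w1 : 0 < `|w| + 1 by rewrite ltr_wpDl.
have := ul (e / (`|w| + 1)) (divr_gt0 e0 w1).
apply: filterS => t; rewrite ltr_pdivlMr// => h.
rewrite -ipBl (le_lt_trans (ip_cauchy_schwarz _ _))// (le_lt_trans _ h)//.
by rewrite ler_wpM2l// lerDl.
Qed.

End hilbert.

Lemma convex_setP (R : realType) (V : lmodType R) (Q : set V) (x y : V) (t : R) :
  convex_set Q -> Q x -> Q y -> 0 <= t -> t <= 1 ->
  Q (t *: x + (1 - t) *: y).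
Proof.
move=> cQ Qx Qy t0 t1.
have := cQ x y (Itv01 t0 t1); rewrite !inE => /(_ Qx Qy).
by [].
Qed.

Lemma cauchy_osc_cvg (R : realType) (V : completeNormedModType R) (T : Type)
    (F : set_system T) (FF : ProperFilter F) (u : T -> V) :
  (forall e : R, 0 < e ->
    exists2 A, F A & forall s t, A s -> A t -> `|u s - u t| <= e) ->
  exists l : V, u t @[t --> F] --> l.
Proof.
move=> h; suff uF : [cvg (u @ F) in V].
  by exists (lim (u @ F)); exact: uF.
apply/cauchy_cvgP; apply: cauchy_exP => e e0.
have e2 : 0 < e / 2 by rewrite divr_gt0.
have [A FA hA] := h _ e2.
have [s As] := filter_ex FA.
exists (u s); change (F (u @^-1` ball (u s) e)); apply: filterS FA => t At; rewrite /preimage /= -ball_normE /ball_ /=.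
by rewrite (le_lt_trans (hA _ _ As At))// ltr_pdivrMr// ltr_pMr// ltr1n.
Qed.

(** * Metric projection onto a closed convex set *)

Section projection.
Context (R : realType) (H : completeNormedModType R) (ip : {dot H for idfun}).
Hypothesis ip_norm : forall u : H, `|u| ^+ 2 = ip u u.
Variable Q : set H.
Hypotheses (Qcl : closed Q) (Qcv : convex_set Q) (Q0 : Q !=set0).

Lemma metric_proj_exists (x : H) :
  exists2 p, Q p & forall y, Q y -> `|x - p| <= `|x - y|.
Proof.
pose S : set R := [set `|x - q| ^+ 2 | q in Q].
have S0 : S !=set0 by have [q Qq] := Q0; exists (`|x - q| ^+ 2), q.
have Slb : has_lbound S by exists 0 => _ [q Qq <-]; exact: sqr_ge0.
have Sinf : has_inf S by [].
have ex n : exists q, Q q /\ `|x - q| ^+ 2 < inf S + n.+1%:R^-1.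
  have [|_ [q Qq <-] hq] := @inf_adherent R S n.+1%:R^-1 _ Sinf.
    by rewrite invr_gt0 ltr0n.
  by exists q.
have [q hq] := choice ex.
have infq y : Q y -> inf S <= `|x - y| ^+ 2.
  by move=> Qy; apply: ge_inf => //; exists y.
(* Parallelogram law: |q m - q n|^2 = 2|x - q m|^2 + 2|x - q n|^2 - 4|x - c|^2 with [c] the
   midpoint. It lies in [Q], so |x - c|^2 >= [inf S], and a minimizing sequence is Cauchy. *)
have qq m n : `|q m - q n| ^+ 2 <= 2 * (m.+1%:R^-1 + n.+1%:R^-1).
  have [Qm hm] := hq m; have [Qn hn] := hq n.
  have Qmid : Q (2^-1 *: q m + (1 - 2^-1) *: q n).
    by apply: convex_setP => //; lra.
  have := infq _ Qmid.
  have -> : x - (2^-1 *: q m + (1 - 2^-1) *: q n) =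
      2^-1 *: ((x - q m) + (x - q n)).
    have -> : 1 - 2^-1 = 2^-1 :> R by lra.
    rewrite -scalerDr addrACA -opprD scalerBr -mulr2n -(scaler_nat 2 x) scalerA.
    by rewrite mulVf ?scale1r// pnatr_eq0.
  have -> : q m - q n = (x - q n) - (x - q m).
    by rewrite opprB [RHS]addrC subrKA.
  rewrite normrZ exprMn (normD2 ip_norm (x - q m)).
  rewrite (normB2 ip_norm (x - q n) (x - q m)) (ipC ip (x - q n)).
  rewrite ger0_norm//.
  have -> : (2^-1 : R) ^+ 2 = 4^-1 by field.
  move: hm hn; set I := inf S; set a := m.+1%:R^-1; set b := n.+1%:R^-1.
  move=> hm hn hI; lra.
have [l ql] : exists l : H, q n @[n --> \oo] --> l.
  apply: cauchy_osc_cvg => e e0.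
  have e4 : 0 < e ^+ 2 / 4 by rewrite divr_gt0// exprn_gt0.
  exists [set n | n.+1%:R^-1 < e ^+ 2 / 4].
    by have := near_infty_natSinv_lt (PosNum e4).
  move=> m n /= hm hn.
  rewrite -ler_sqr ?nnegrE// ?(ltW e0)//.
  apply: le_trans (qq m n) _; move: hm hn.
  by set a := m.+1%:R^-1; set b := n.+1%:R^-1 => hm hn; lra.
have Ql : Q l.
  apply: (closed_cvg Q Qcl _ l ql).
  by apply: nearW => n; have [] := hq n.
exists l => // y Qy.
rewrite -ler_sqr ?nnegrE//.
apply: le_trans (infq _ Qy).
have c1 : `|x - q n| ^+ 2 @[n --> \oo] --> `|x - l| ^+ 2.
  have c2 : `|x - q n| @[n --> \oo] --> `|x - l|.
    by apply: cvg_norm; apply: cvgB => //; exact: cvg_cst.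
  by rewrite expr2; apply: cvgM.
have c3 : inf S + n.+1%:R^-1 @[n --> \oo] --> inf S.
  rewrite -[X in _ --> X]addr0; apply: cvgD; first exact: cvg_cst.
  exact: cvg_harmonic.
apply: ler_cvg_to c1 c3 _; apply: nearW => n.
by have [_ /ltW] := hq n.
Qed.

Lemma metric_projP (x : H) :
  Q (metric_proj Q x) /\ forall y, Q y -> `|x - metric_proj Q x| <= `|x - y|.
Proof.
have [p Qp hp] := metric_proj_exists x.
by apply: (@getPex _ [set p : H | Q p /\ forall y, Q y -> `|x - p| <= `|x - y|]); exists p.
Qed.

Lemma metric_proj_in x : Q (metric_proj Q x).
Proof. by have [] := metric_projP x. Qed.

Lemma metric_proj_vi x y : Q y ->
  ip (x - metric_proj Q x) (y - metric_proj Q x) <= 0.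
Proof.
move=> Qy; have [Qp hp] := metric_projP x; set p := metric_proj Q x in Qp hp *.
rewrite leNgt; apply/negP => a0.
set a := ip _ _ in a0; set b := `|y - p| ^+ 2.
have b0 : 0 <= b by exact: sqr_ge0.
have ab0 : 0 < a + b by lra.
(* Moving from [p] towards [y] by [t] changes the squared distance to [x] by [t * (t * b - 2 * a)],
   which is negative once [t * b < 2 * a]. The denominator [a + b] ensures this, keeps [t <= 1] and
   is nonzero even if [b = 0]. *)
pose t := a / (a + b).
have t0 : 0 < t by rewrite divr_gt0.
have t1 : t <= 1 by rewrite ler_pdivrMr// mul1r; lra.
have := hp _ (convex_setP Qcv Qy Qp (ltW t0) t1).
have -> : x - (t *: y + (1 - t) *: p) = (x - p) - t *: (y - p).
  rewrite scalerBl scale1r scalerBr !opprD !opprK.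
  by rewrite -!addrA; congr (_ + _); rewrite addrC -addrA; congr (_ + _); rewrite addrC.
rewrite -ler_sqr ?nnegrE// [X in _ <= X](normB2 ip_norm) ipZr normrZ exprMn.
rewrite (ger0_norm (ltW t0)) -/a -/b => h.
have : t * (2 * a - t * b) <= 0 by lra.
rewrite pmulr_rle0// subr_le0 /t mulrAC ler_pdivlMr//.
nra.
Qed.

(** Each variational inequality is tested with the other projection; their sum is |p - q|^2 <= <x -
    y, p - q>, and Cauchy-Schwarz concludes. *)
Lemma metric_proj_nonexp x y :
  `|metric_proj Q x - metric_proj Q y| <= `|x - y|.
Proof.
set p := metric_proj Q x; set q := metric_proj Q y.
have h1 := metric_proj_vi x (metric_proj_in y).
have h2 := metric_proj_vi y (metric_proj_in x).
rewrite -/p -/q in h1 h2.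
have h : `|p - q| ^+ 2 <= ip (x - y) (p - q).
  rewrite ip_norm.
  move: h1 h2; rewrite !(ipBl, ipBr); lra.
have [->|pq] := eqVneq p q; first by rewrite subrr normr0.
have pq0 : 0 < `|p - q| by rewrite normr_gt0 subr_eq0.
have := le_trans h (ip_le_norm ip_norm _ _).
by rewrite expr2 ler_pM2r.
Qed.

Lemma metric_proj_continuous : continuous (metric_proj Q).
Proof.
move=> u; apply/cvgrPdist_lt => e e0; near=> v.
apply: le_lt_trans (metric_proj_nonexp _ _) _.
by near: v; apply: cvgr_dist_lt.
Unshelve. all: by end_near. Qed.

Lemma metric_proj_id x : Q x -> metric_proj Q x = x.
Proof.
move=> Qx; have [_ /(_ x Qx)] := metric_projP x.
by rewrite subrr normr0 normr_le0 subr_eq0 => /eqP.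
Qed.

End projection.

(** * The Riesz representation theorem *)

Section riesz.
Context (R : realType) (H : completeNormedModType R) (ip : {dot H for idfun}).
Hypothesis ip_norm : forall u : H, `|u| ^+ 2 = ip u u.

(** [phi] is a plain function with linearity and boundedness as hypotheses, to cover functionals
    defined by integrals or by limits. For [u] outside the kernel [K], the vector w = u - P_K u is
    orthogonal to [K], and each [v] equals (phi v / phi w) w modulo [K]; the representative is a
    multiple of [w]. *)
Lemma riesz (phi : H -> R) (C : R) :
  (forall a u v, phi (a *: u + v) = a * phi u + phi v) ->
  (forall u, `|phi u| <= C * `|u|) ->
  exists g, forall v, phi v = ip g v.
Proof.
move=> lin bnd.
have phi0 : phi 0 = 0 by have := lin 1 0 0; rewrite scaler0 addr0; lra.
have phiZ a u : phi (a *: u) = a * phi u.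
  by rewrite -[a *: u]addr0 lin phi0 addr0.
have phiD u v : phi (u + v) = phi u + phi v.
  by rewrite -[u]scale1r lin mul1r scale1r.
have phiB u v : phi (u - v) = phi u - phi v.
  by rewrite phiD -[- v]scaleN1r phiZ mulN1r.
have [h|] := pselect (forall u, phi u = 0).
  by exists 0 => v; rewrite h ip0l.
move/existsNP => [u /eqP u0].
pose K := [set v | phi v = 0].
have phic : continuous phi.
  move=> x; apply/cvgrPdist_lt => e e0.
  have C1 : 0 < `|C| + 1 by rewrite ltr_wpDl.
  near=> y; rewrite -phiB (le_lt_trans (bnd _))//.
  apply: (@le_lt_trans _ _ ((`|C| + 1) * `|x - y|)).
    by rewrite ler_wpM2r// (le_trans (ler_norm _))// lerDl.
  rewrite mulrC -ltr_pdivlMr//; near: y.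
  by apply: cvgr_dist_lt => //; exact: divr_gt0.
have Kcl : closed K.
  have -> : K = phi @^-1` [set 0] by [].
  by apply: preimage_closed => [x _|]; [exact: phic|exact: closed_eq].
have Kcv : convex_set K.
  move=> x y l; rewrite !inE /K /= => Kx Ky.
  by rewrite lin phiZ Kx Ky !mulr0 addr0.
have K0 : K !=set0 by exists 0.
pose p := metric_proj K u.
have Kp : K p by exact: metric_proj_in.
pose w := u - p.
have ortho v : K v -> ip w v = 0.
  move=> Kv; apply/eqP; rewrite eq_le; apply/andP; split.
    have /(_ (p + v)) := @metric_proj_vi _ _ _ ip_norm K Kcl Kcv K0 u.
    rewrite -/p -/w addrAC subrr add0r; apply.
    by rewrite /K /= phiD Kp Kv addr0.
  have /(_ (p - v)) := @metric_proj_vi _ _ _ ip_norm K Kcl Kcv K0 u.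
  rewrite -/p -/w addrAC subrr add0r ipNr oppr_le0; apply.
  by rewrite /K /= phiB Kp Kv subr0.
have phiw : phi w = phi u by rewrite phiB Kp subr0.
have ww : ip w w != 0.
  rewrite -ip_norm sqrf_eq0 normr_eq0; apply/eqP => w0.
  by move: u0; rewrite -phiw w0 phi0 eqxx.
exists ((phi w / ip w w) *: w) => v.
have : K (v - (phi v / phi w) *: w).
  by rewrite /K /= phiB phiZ phiw -mulrA mulVf// mulr1 subrr.
move=> /ortho; rewrite ipBr ipZr ipZl => /eqP; rewrite subr_eq0 => /eqP ->.
by rewrite phiw; field; rewrite ww u0.
Unshelve. all: by end_near. Qed.

End riesz.

(** * Gradients of convex functions *)

Section gradient.
Context (R : realType) (H : completeNormedModType R) (ip : {dot H for idfun}).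
Hypothesis ip_norm : forall u : H, `|u| ^+ 2 = ip u u.
Variable f : H -> R.

(** [gradient] is chosen by [get], so its defining property holds only once a representative is
    known to exist; the differential is continuous and linear, hence bounded, and Riesz provides
    one. *)
Lemma gradientE (x v : H) : differentiable f x ->
  'd f x v = ip (gradient ip f x) v.
Proof.
move=> fx; have [k k0 hk] := linear_lipschitz (diff_continuous fx).
have lin a u w : 'd f x (a *: u + w) = a * 'd f x u + 'd f x w.
  by rewrite linearP.
have [g hg] := @riesz R H ip ip_norm ('d f x) k lin hk.
have := @getPex _ [set g : H | forall v, 'd f x v = ip g v] (ex_intro _ g hg).
exact.
Qed.

Hypotheses (f_diff : forall x, differentiable f x)
  (f_convex : convex_function [set: H] f).

(** By convexity the difference quotient in the direction [y - x] with step in (0, 1] never exceeds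
    [f y - f x]; were the directional derivative larger, a small step would contradict this. *)
Lemma gradient_ineq (x y : H) : f x + ip (gradient ip f x) (y - x) <= f y.
Proof.
rewrite -gradientE// -deriveE// addrC -lerBrDr leNgt; apply/negP => lt.
have := @diff_derivable _ _ _ f x (y - x) (f_diff x).
rewrite /derivable => cv.
have {}cv : (h^-1 *: ((f \o shift x) (h *: (y - x)) - f x)) @[h --> 0^'] -->
    'D_(y - x) f x by [].
have e0 : 0 < 'D_(y - x) f x - (f y - f x) by rewrite subr_gt0.
have /cvgrPdist_lt/(_ _ e0) := cv.
rewrite near_withinE => /nbhs_ballP[d /= d0 hd].
pose h := Num.min (d / 2) 2^-1.
have h0 : 0 < h by rewrite lt_min divr_gt0//= invr_gt0.
have h1 : h <= 1 by rewrite ge_min; apply/orP; right; lra.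
have hd2 : h < d.
  rewrite gt_min; apply/orP; left; lra.
have := hd h; rewrite -ball_normE /ball_ /= sub0r normrN gtr0_norm//.
move=> /(_ hd2 (lt0r_neq0 h0)).
have := f_convex (Itv01 (ltW h0) h1) (mem_set (I : setT y)) (mem_set (I : setT x)).
rewrite /conv /= => hc.
have {}hc : f (h *: (y - x) + x) <= h * f y + (1 - h) * f x.
  apply: le_trans hc; rewrite le_eqVlt; apply/orP; left; apply/eqP; congr f.
  by rewrite scalerBl scale1r scalerBr addrAC -addrA addrC -addrA.
rewrite ltr_norml => /andP[_].
rewrite /GRing.scale /= => lt2.
have lt3 : f y - f x < h^-1 * (f (h *: (y - x) + x) - f x) by lra.
move: lt3; rewrite mulrC ltr_pdivlMr//; nra.
Qed.

End gradient.

Lemma locally_lipschitzP (R : realType) (V W : normedModType R) (g : V -> W) :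
  [locally [lipschitz g x | x in [set: V]]] ->
  forall x, exists L r : R, [/\ 0 < L, 0 < r & forall a b,
    `|x - a| < r -> `|x - b| < r -> `|g a - g b| <= L * `|a - b|].
Proof.
move=> gl x; have := gl (x, x) (conj I I).
move=> [M [_ hM]].
have := hM (`|M| + 1); rewrite (le_lt_trans (ler_norm _)) ?ltrDl// => /(_ isT).
rewrite /dominated_by /= /within /= => -[[A B] /= [/nbhs_ballP[r /= r0 rA]]].
move=> /nbhs_ballP[s /= s0 sB] AB.
exists (`|M| + 1), (Num.min r s); split.
- by rewrite ltr_wpDl.
- by rewrite lt_min r0.
- move=> a b; rewrite !lt_min => /andP[ar _] /andP[_ bs].
  have /AB/(_ (conj I I)) : (A `*` B) (a, b).
    by split => /=; [apply: rA|apply: sB]; rewrite -ball_normE.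
  by [].
Qed.

(** * One-sided differential calculus *)

(** The supremum [c] of the times up to which [P] holds throughout is such a time by the left-limit
    rule, and the right-extension rule forbids [c < b]. This replaces compactness of [a, b] in the
    proofs of monotonicity, uniqueness, continuation and bounded variation. *)
Lemma real_induction (R : realType) (a b : R) (P : R -> Prop) :
  P a ->
  (forall t, a <= t < b -> (forall s, a <= s <= t -> P s) ->
    exists2 d : R, 0 < d & forall s, t < s < t + d -> s <= b -> P s) ->
  (forall t, a < t <= b -> (forall s, a <= s < t -> P s) -> P t) ->
  forall t, a <= t <= b -> P t.
Proof.
move=> Pa Pr Pl t0 /andP[at0 t0b]; have ab := le_trans at0 t0b.
pose S : set R := [set t | a <= t <= b /\ forall s, a <= s <= t -> P s].
have Sa : S a.
  split; first by rewrite lexx.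
  by move=> s sa; have -> : s = a by apply: le_anti; rewrite andbC.
have Sub : has_ubound S by exists b => t [/andP[]].
have Ssup : has_sup S by split; [exists a|].
set c := sup S.
have ac : a <= c by exact: ub_le_sup.
have cb : c <= b by apply: ge_sup; [exists a|move=> t [/andP[]]].
have below s : a <= s < c -> P s.
  move=> /andP[as_ sc]; have cs : 0 < c - s by rewrite subr_gt0.
  have [t [_ Pt]] := sup_adherent cs Ssup.
  by rewrite subKr => st; apply: Pt; rewrite as_ ltW.
have Sc : S c.
  split; first by rewrite ac.
  move=> s /andP[as_]; rewrite le_eqVlt => /predU1P[->|sc]; last first.
    by apply: below; rewrite as_.
  by move: ac; rewrite le_eqVlt => /predU1P[<-//|ac]; apply: Pl; rewrite ?ac.
have [_ Pc] := Sc.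
move: cb; rewrite le_eqVlt => /predU1P[cb|cb].
  by apply: Pc; rewrite at0 cb.
have [|d d0 hd] := Pr c _ Pc; first by rewrite ac.
pose s := Num.min b (c + d / 2).
have cs : c < s by rewrite lt_min cb ltrDl divr_gt0.
have sd : s < c + d by rewrite gt_min; apply/orP; right; lra.
have sb : s <= b by rewrite ge_min lexx.
suff : S s by move=> /(ub_le_sup Sub); rewrite leNgt cs.
split; first by rewrite (le_trans ac (ltW cs)).
move=> r /andP[ar rs]; have [rc|cr] := leP r c.
  by apply: Pc; rewrite ar.
by apply: hd; [rewrite cr (le_lt_trans rs)|exact: le_trans sb].
Qed.

(** The hypothesis bounds the right and the left upper Dini derivatives of [G] by 0. Real induction
    proves [G t - G a <= e * (t - a)]; the left half of the hypothesis takes the place of left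
    continuity at the limit step. *)
Lemma straddle_nonincreasing (R : realType) (a b : R) (G : R -> R) : a <= b ->
  (forall t e, a <= t <= b -> 0 < e -> exists2 d : R, 0 < d &
    forall s, a <= s <= b -> `|s - t| < d ->
      (t <= s -> G s - G t <= e * (s - t)) /\
      (s <= t -> G t - G s <= e * (t - s))) ->
  G b <= G a.
Proof.
move=> ab h; suff k e : 0 < e -> G b - G a <= e * (b - a).
  move: ab; rewrite le_eqVlt => /predU1P[->//|ab].
  have ba : 0 < b - a by rewrite subr_gt0.
  apply/ler_addgt0Pr => e e0; have := k (e / (b - a)) (divr_gt0 e0 ba).
  by rewrite divfK ?gt_eqF//; lra.
move=> e0; apply: (@real_induction _ a b (fun t => G t - G a <= e * (t - a))).
- by rewrite !subrr mulr0.
- move=> t /andP[at_ tb] Pt.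
  have [|d d0 hd] := h t e _ e0; first by rewrite at_ ltW.
  exists d => // s /andP[ts std] sb.
  have [||+ _] := hd s; [by rewrite (le_trans at_ (ltW ts))| |].
    by rewrite gtr0_norm ?subr_gt0//; lra.
  move=> /(_ (ltW ts)); have : G t - G a <= e * (t - a) by apply: Pt; rewrite at_ lexx.
  lra.
- move=> t /andP[at_ tb] Pt.
  have [|d d0 hd] := h t e _ e0; first by rewrite tb ltW.
  pose s := Num.max a (t - d / 2).
  have as_ : a <= s by rewrite le_max lexx.
  have st : s < t by rewrite gt_max at_ /=; lra.
  have tds : t - d < s by rewrite lt_max; apply/orP; right; lra.
  have [||_ ] := hd s; [by rewrite as_ (le_trans (ltW st) tb)| |].
    by rewrite distrC gtr0_norm ?subr_gt0//; lra.
  move=> /(_ (ltW st)); have : G s - G a <= e * (s - a) by apply: Pt; rewrite as_.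
  lra.
- by rewrite ab lexx.
Qed.

Lemma subBACA (V : zmodType) (a b c d : V) : a - b - (c - d) = a - c - (b - d).
Proof. by rewrite !opprB addrACA [RHS]addrACA [- b - c]addrC. Qed.

(** Without a quotient or a chosen limit, this form restricts to subsets and passes to unions of
    domains. At an isolated point of [D] it holds for every [v], which starts the continuation of
    solutions from the interval [0, 0]. *)
Definition has_deriv_within (R : realType) (V : normedModType R) (D : set R)
    (x : R -> V) (t : R) (v : V) : Prop :=
  forall e : R, 0 < e -> exists2 d : R, 0 < d &
    forall s, D s -> `|s - t| < d -> `|x s - x t - (s - t) *: v| <= e * `|s - t|.

Section deriv_within.
Context (R : realType) (V : normedModType R).
Implicit Types (D : set R) (x y : R -> V) (t : R).

Lemma has_deriv_withinS D D' x t v : D' `<=` D ->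
  has_deriv_within D x t v -> has_deriv_within D' x t v.
Proof.
move=> DD' h e /h[d d0 hd]; exists d => // s /DD'; exact: hd.
Qed.

Lemma has_deriv_within_eq D x y t v r : 0 < r -> x t = y t ->
  (forall s, D s -> `|s - t| < r -> x s = y s) ->
  has_deriv_within D x t v -> has_deriv_within D y t v.
Proof.
move=> r0 xyt xy h e /h[d d0 hd]; exists (Num.min d r).
  by rewrite lt_min d0.
move=> s Ds; rewrite lt_min => /andP[sd sr].
by rewrite -xyt -(xy s)//; exact: hd.
Qed.

Lemma has_deriv_withinU D D' x t v : has_deriv_within D x t v ->
  has_deriv_within D' x t v -> has_deriv_within (D `|` D') x t v.
Proof.
move=> h h' e e0; have [d d0 hd] := h e e0; have [d' d'0 hd'] := h' e e0.
exists (Num.min d d'); first by rewrite lt_min d0.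
by move=> s [Ds|Ds]; rewrite lt_min => /andP[? ?]; [exact: hd|exact: hd'].
Qed.

Lemma has_deriv_withinB D x y t v w : has_deriv_within D x t v ->
  has_deriv_within D y t w ->
  has_deriv_within D (fun s => x s - y s) t (v - w).
Proof.
move=> hx hy e e0; have e2 : 0 < e / 2 by rewrite divr_gt0.
have [d d0 hd] := hx _ e2; have [d' d'0 hd'] := hy _ e2.
exists (Num.min d d'); first by rewrite lt_min d0.
move=> s Ds; rewrite lt_min => /andP[sd sd'].
have := hd s Ds sd; have := hd' s Ds sd' => h1 h2.
have -> : x s - y s - (x t - y t) - (s - t) *: (v - w) =
   (x s - x t - (s - t) *: v) - (y s - y t - (s - t) *: w).
  by rewrite scalerBr (subBACA (x s)) (subBACA (x s - x t)).
apply: le_trans (ler_normB _ _) _; lra.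
Qed.

Lemma has_deriv_withinZ D x t v a : has_deriv_within D x t v ->
  has_deriv_within D (fun s => a *: x s) t (a *: v).
Proof.
move=> hx e e0; have a1 : 0 < `|a| + 1 by rewrite ltr_wpDl.
have [d d0 hd] := hx (e / (`|a| + 1)) (divr_gt0 e0 a1).
exists d => // s Ds sd; rewrite scalerA (mulrC _ a) -scalerA -!scalerBr normrZ.
have := hd s Ds sd.
rewrite -mulrA mulrCA => h.
apply: (@le_trans _ _ ((`|a| + 1) * `|x s - x t - (s - t) *: v|)).
  by rewrite ler_wpM2r// lerDl.
by move: h; rewrite -ler_pdivlMl// mulrA mulrC.
Qed.

Lemma has_deriv_within_cst D t (c : V) : has_deriv_within D (fun=> c) t 0.
Proof.
move=> e e0; exists 1 => // s _ _.
by rewrite subrr scaler0 subrr normr0 mulr_ge0// ltW.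
Qed.

Lemma has_deriv_within_cvg D x t v : has_deriv_within D x t v ->
  forall e, 0 < e -> exists2 d : R, 0 < d &
    forall s, D s -> `|s - t| < d -> `|x s - x t| < e.
Proof.
move=> h e e0; have [d d0 hd] := h 1 ltr01.
have v2 : 0 < `|v| + 2 by rewrite ltr_wpDl.
exists (Num.min d (e / (`|v| + 2))); first by rewrite lt_min d0 divr_gt0.
move=> s Ds; rewrite lt_min => /andP[sd]; rewrite ltr_pdivlMr// => se.
have := hd s Ds sd; rewrite mul1r => h1.
have -> : x s - x t = (x s - x t - (s - t) *: v) + (s - t) *: v by rewrite subrK.
apply: le_lt_trans (ler_normD _ _) _; rewrite normrZ.
apply: le_lt_trans se.
have := normr_ge0 (s - t); nra.
Qed.

(** The norm of an increment need not be differentiable, so [|x t - x a| - A t] is shown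
    nonincreasing by straddling; by the triangle inequality ([key]) its increments are controlled by
    those of [x] and [A]. *)
Lemma mean_value_dom (a b : R) x (v : R -> V) (A A' : R -> R) : a <= b ->
  (forall t, a <= t <= b -> has_deriv_within `[a, b] x t (v t)) ->
  (forall t, a <= t <= b -> @has_deriv_within R R^o `[a, b] A t (A' t)) ->
  (forall t, a <= t <= b -> `|v t| <= A' t) ->
  `|x b - x a| <= A b - A a.
Proof.
move=> ab hx hA hv.
suff : `|x b - x a| - A b <= `|x a - x a| - A a by rewrite subrr normr0; lra.
have key p q : (`|x q - x a| - A q) - (`|x p - x a| - A p) <=
    `|x q - x p| - (A q - A p).
  have : `|x q - x a| <= `|x q - x p| + `|x p - x a|.
    by rewrite -(subrKA (x p)) ler_normD.
  lra.
apply: (@straddle_nonincreasing _ a b (fun t => `|x t - x a| - A t)) => // t e tab e0.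
have e2 : 0 < e / 2 by rewrite divr_gt0.
have [d d0 hd] := hx t tab _ e2; have [d' d'0 hd'] := hA t tab _ e2.
exists (Num.min d d'); first by rewrite lt_min d0.
move=> s sab; rewrite lt_min => /andP[sd sd'].
have S : `[a, b]%classic s by rewrite /= in_itv.
have := hd s S sd; have := hd' s S sd'.
rewrite ler_norml => /andP[hl hr] h1.
have h2 : `|x s - x t| <= e / 2 * `|s - t| + `|s - t| * A' t.
  rewrite -(subrK ((s - t) *: v t) (x s - x t)) (le_trans (ler_normD _ _))//.
  by rewrite lerD// normrZ ler_wpM2l// hv.
split=> st.
  have := key t s; move: hl hr h2.
  rewrite /GRing.scale /= (ger0_norm (_ : 0 <= s - t)) ?subr_ge0//; nra.
have := key s t; move: hl hr h2; rewrite (distrC (x t) (x s)).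
rewrite /GRing.scale /= (ler0_norm (_ : s - t <= 0)) ?subr_le0//; nra.
Qed.

Lemma mean_value_le (a b M : R) x (v : R -> V) w : a <= b ->
  (forall t, a <= t <= b -> has_deriv_within `[a, b] x t (v t)) ->
  (forall t, a <= t <= b -> `|v t - w| <= M) ->
  `|x b - x a - (b - a) *: w| <= M * (b - a).
Proof.
move=> ab hx hv.
have lin (W : normedModType R) (c : W) (D : set R) (t : R) :
    has_deriv_within D (fun s => s *: c) t c.
  move=> e e0; exists 1 => // s _ _.
  by rewrite scalerBl subrr normr0 mulr_ge0// ltW.
have := @mean_value_dom a b (fun t => x t - t *: w) (fun t => v t - w)
  (fun t => t * M) (fun=> M) ab.
rewrite (subBACA (x b)) -scalerBl -mulrBl mulrC; apply => // t tab.
  by apply: has_deriv_withinB; [exact: hx|exact: lin].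
exact: (lin R^o).
Qed.

End deriv_within.

Lemma continuous_deriv_max (R : realType) (V : normedModType R) (x v : R -> V)
    (a : R) :
  (forall t, a <= t -> has_deriv_within `[a, +oo[ x t (v t)) ->
  continuous (fun t => x (Num.max a t)).
Proof.
move=> hx t; apply/cvgrPdist_lt => e e0.
have at_ : a <= Num.max a t by rewrite le_max lexx.
have [d d0 hd] := has_deriv_within_cvg (hx _ at_) e0.
near=> s; rewrite distrC; apply: hd.
  by rewrite /= in_itv /= andbT le_max lexx.
apply: (@le_lt_trans _ _ `|t - s|); last first.
  by near: s; apply: cvgr_dist_lt.
rewrite (distrC t); rewrite !maxEle; case: ifPn => h1; case: ifPn => h2 //.
- have h3 : t < a by rewrite ltNge.
  by rewrite !ger0_norm ?subr_ge0// ?(le_trans (ltW h3))//; lra.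
- have h3 : s < a by rewrite ltNge.
  rewrite (distrC a) (distrC s) !ger0_norm ?subr_ge0// ?(le_trans (ltW h3))//.
  by rewrite lerD2l lerN2 ltW.
- by rewrite subrr normr0.
Unshelve. all: by end_near. Qed.

(** * Primitives of continuous real-valued and Hilbert-valued functions *)

Section primitive_real.
Context (R : realType) (h : R -> R).
Hypothesis hc : continuous h.
Notation mu := (@lebesgue_measure R).

Lemma continuous_itv_integrable (a b : R) :
  mu.-integrable `[a, b] (EFin \o h).
Proof.
apply: continuous_compact_integrable; first exact: segment_compact.
exact: continuous_subspaceT.
Qed.

Lemma derivable_has_deriv (F : R -> R) t (D : set R) : derivable F t 1 ->
  @has_deriv_within R R^o D F t (derive1 F t).
Proof.
move=> dF e e0.
have : h0^-1 *: (F (h0 + t) - F t) @[h0 --> 0^'] --> derive1 F t.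
  rewrite derive1E; move: dF; rewrite /derivable /derive /=.
  by under eq_fun do rewrite /GRing.scale /= mulr1.
move=> /cvgrPdist_lt/(_ _ e0); rewrite near_withinE => /nbhs_ballP[d /= d0 hd].
exists d => // s _ std; have [->|st] := eqVneq s t.
  by rewrite !subrr scale0r subrr normr0 mulr0.
have := hd (s - t); rewrite -ball_normE /ball_ /= sub0r normrN subr_eq0.
move=> /(_ std st) /ltW; rewrite subrK => hh.
rewrite -ler_pdivrMr ?normr_gt0 ?subr_eq0// -normfV -normrM.
apply: le_trans hh; rewrite le_eqVlt; apply/orP; left; apply/eqP.
rewrite distrC; congr (`| _ |); rewrite /GRing.scale /=; field.
by rewrite subr_eq0.
Qed.

Lemma Rintegral_has_deriv (a t : R) : a <= t ->
  @has_deriv_within R R^o `[a, +oo[ (fun s => \int[mu]_(r in `[a, s]) h r) t (h t).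
Proof.
(* Integrating from [a - 1] makes [a] an interior point, so the two-sided fundamental theorem also
   covers [t = a]; on [a, +oo) the two primitives differ by the constant [F a]. *)
move=> at_; pose F s := \int[mu]_(r in `[a - 1, s]) h r.
have a1t : a - 1 < t by lra.
have tt1 : t < t + 1 by lra.
have [dF F't] := continuous_FTC1_closed tt1
  (continuous_itv_integrable (a - 1) (t + 1)) a1t (@hc t).
have := @derivable_has_deriv _ _ `[a, +oo[ dF.
rewrite F't => hF.
have FE s : a <= s -> \int[mu]_(r in `[a, s]) h r = F s - F a.
  move=> as_; rewrite /F Rintegral_itvB.
  - rewrite Rintegral_itv_obnd_cbnd//.
    apply: integrableS (continuous_itv_integrable a s) => //.
    by apply: subset_itvr; rewrite bnd_simp.
  - exact: continuous_itv_integrable.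
  - by rewrite bnd_simp; lra.
  - by rewrite bnd_simp.
have := @has_deriv_withinB _ R^o _ _ _ _ _ _ hF (@has_deriv_within_cst _ R^o _ t (F a)).
rewrite subr0; apply: (@has_deriv_within_eq _ _ _ _ _ _ _ 1) => //.
  by rewrite FE.
by move=> s; rewrite /= in_itv /= andbT => as_ _; rewrite FE.
Qed.

End primitive_real.

Section primitive_hilbert.
Context (R : realType) (H : completeNormedModType R) (ip : {dot H for idfun}).
Hypothesis ip_norm : forall u : H, `|u| ^+ 2 = ip u u.

Lemma ler_norm_ip (u : H) (M : R) : 0 <= M ->
  (forall v, `|ip u v| <= M * `|v|) -> `|u| <= M.
Proof.
move=> M0 hM; have [->|u0] := eqVneq u 0; first by rewrite normr0.
have := hM u; rewrite -ip_norm ger0_norm ?sqr_ge0// expr2 ler_pM2r//.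
by rewrite normr_gt0.
Qed.

(* The vector-valued integral is the Riesz representative of
   [v |-> \int ip (g r) v]. *)
Lemma hilbert_primitive (g : R -> H) (a : R) (y0 : H) : continuous g ->
  exists G : R -> H, [/\ continuous G, G a = y0 &
    forall t, a <= t -> has_deriv_within `[a, +oo[ G t (g t)].
Proof.
move=> gc.
have gvc v : continuous (fun r => ip (g r) v).
  by move=> t; apply: ip_cvgl => //; exact: gc.
pose I v t := \int[lebesgue_measure]_(r in `[a, t]) ip (g r) v.
have hI v t : a <= t -> @has_deriv_within R R^o `[a, +oo[ (I v) t (ip (g t) v).
  by move=> at_; exact: Rintegral_has_deriv (gvc v) _ _ at_.
have Ia v : I v a = 0 by rewrite /I set_itv1 Rintegral_set1.
have hMV v p q w M : a <= p -> p <= q ->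
    (forall r, p <= r <= q -> `|ip (g r) v - w| <= M) ->
    `|I v q - I v p - (q - p) * w| <= M * (q - p).
  move=> ap pq hM.
  apply: (@mean_value_le R R^o p q M (I v) (fun r => ip (g r) v)) => // t /andP[pt tq].
  apply: has_deriv_withinS (hI v t (le_trans ap pt)) => r /=.
  by rewrite !in_itv /= andbT => /andP[pr _]; exact: le_trans pr.
have ex t : exists G, a <= t -> forall v, I v t = ip G v.
  have [at_|ta] := leP a t; last by exists 0.
  have /compact_bounded [M [_ hM]] : compact (g @` `[a, t]).
    apply: continuous_compact; last exact: segment_compact.
    exact: continuous_subspaceT.
  have {}hM r : a <= r <= t -> `|g r| <= `|M| + 1.
    move=> art; apply: (hM (`|M| + 1)).
      by rewrite (le_lt_trans (ler_norm _))// ltrDl.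
    by exists r => //; rewrite /= in_itv.
  have [G hG] : exists G, forall v, I v t = ip G v; last by exists G.
  apply: (@riesz _ _ _ ip_norm (fun v => I v t) ((`|M| + 1) * (t - a))).
    move=> c u v; rewrite /I -RintegralZl//; last first.
      exact: continuous_itv_integrable (gvc u) _ _.
    rewrite -RintegralD//.
    - by apply: eq_Rintegral => r _; rewrite ipDr ipZr.
    - have cc : continuous (fun r => c * ip (g r) u).
        by move=> r; apply: cvgM; [exact: cvg_cst|exact: gvc].
      exact: continuous_itv_integrable cc _ _.
    - exact: continuous_itv_integrable (gvc v) _ _.
  move=> v.
  have := hMV v a t 0 ((`|M| + 1) * `|v|) (lexx a) at_.
  rewrite Ia mulr0 !subr0 mulrAC => -> // r art.
  rewrite subr0 (le_trans (ip_cauchy_schwarz ip_norm _ _))// ler_wpM2r//.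
  exact: hM.
have [G0 hG0] := choice ex.
have G0a : G0 a = 0.
  by apply: (ip_injl ip_norm) => w; rewrite -hG0// Ia ip0l.
(* The radius [d] comes from the norm continuity of [g] and is thus the same for all test vectors
   [v]; this uniformity lets [ler_norm_ip] turn scalar estimates into a derivative in norm. *)
have hG t : a <= t -> has_deriv_within `[a, +oo[ G0 t (g t).
  move=> at_ e e0.
  have := gc t => /cvgrPdist_lt/(_ _ e0)/nbhs_ballP[d /= d0 hd].
  exists d => // s; rewrite /= in_itv /= andbT => as_ std.
  apply: ler_norm_ip => [|v]; first by rewrite mulr_ge0// ltW.
  rewrite !ipBl ipZl -!hG0//.
  have near_t r : `|r - t| <= `|s - t| -> `|ip (g r) v - ip (g t) v| <= e * `|v|.
    move=> rs; rewrite -ipBl (le_trans (ip_cauchy_schwarz ip_norm _ _))//.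
    rewrite ler_wpM2r// distrC ltW//; apply: hd.
    by rewrite -ball_normE /ball_ /= distrC (le_lt_trans rs).
  have [ts|st] := leP t s.
    have st0 : 0 <= s - t by rewrite subr_ge0.
    rewrite (ger0_norm st0) mulrAC; apply: hMV => // r /andP[tr rs].
    apply: near_t; rewrite !ger0_norm ?subr_ge0// lerD2r//.
  have ts0 : 0 <= t - s by rewrite subr_ge0 ltW.
  rewrite (distrC s) (ger0_norm ts0) mulrAC.
  have -> : `|I v s - I v t - (s - t) * ip (g t) v| =
            `|I v t - I v s - (t - s) * ip (g t) v|.
    by rewrite -normrN; congr (`| _ |); ring.
  apply: hMV => //; first exact: ltW.
  move=> r /andP[sr rt]; apply: near_t.
  by rewrite (distrC r) (distrC s) !ger0_norm ?subr_ge0 ?(ltW st)// lerD2l lerN2.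
exists (fun t => G0 (Num.max a t) + y0); split.
- move=> t; apply: cvgD; last exact: cvg_cst.
  exact: (continuous_deriv_max hG).
- by rewrite maxxx G0a add0r.
move=> t at_; rewrite -[g t]subr0.
have := has_deriv_withinB (hG t at_) (has_deriv_within_cst _ t (- y0)).
apply: (@has_deriv_within_eq _ _ _ _ _ _ _ 1) => //.
  by rewrite opprK (max_idPr at_).
by move=> s; rewrite /= in_itv /= andbT => as_ _; rewrite opprK (max_idPr as_).
Qed.

End primitive_hilbert.

Lemma has_deriv_within_near (R : realType) (V : normedModType R) (D D' : set R)
    (x y : R -> V) t v r : 0 < r -> x t = y t ->
  (forall s, D' s -> `|s - t| < r -> D s /\ x s = y s) ->
  has_deriv_within D x t v -> has_deriv_within D' y t v.
Proof.
move=> r0 xyt xy h e /h[d d0 hd]; exists (Num.min d r).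
  by rewrite lt_min d0.
move=> s D's; rewrite lt_min => /andP[sd sr].
have [Ds <-] := xy s D's sr.
by rewrite -xyt; exact: hd.
Qed.

(** At the junction [b] the derivatives from both sides agree because each is the value of the same
    field at the same point. *)
Lemma has_deriv_within_glue (R : realType) (V : normedModType R) (a b c : R)
    (x y : R -> V) (F : R -> V -> V) : a <= b -> b <= c -> x b = y b ->
  (forall t, a <= t <= b -> has_deriv_within `[a, b] x t (F t (x t))) ->
  (forall t, b <= t <= c -> has_deriv_within `[b, c] y t (F t (y t))) ->
  let z t := if t <= b then x t else y t in
  forall t, a <= t <= c -> has_deriv_within `[a, c] z t (F t (z t)).
Proof.
move=> ab bc xyb hx hy z t /andP[at_ tc]; rewrite /z; have [tb|bt|tb] := ltgtP t b.
- apply: (@has_deriv_within_near _ _ `[a, b] _ x _ _ _ (b - t)).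
  + by rewrite subr_gt0.
  + by rewrite (ltW tb).
  + move=> s; rewrite /= !in_itv /= => /andP[as_ sc] sbt.
    have sb : s <= b by move: sbt; rewrite ltr_norml => /andP[_]; lra.
    by rewrite as_ sb.
  + by apply: hx; rewrite at_ ltW.
- apply: (@has_deriv_within_near _ _ `[b, c] _ y _ _ _ (t - b)).
  + by rewrite subr_gt0.
  + by rewrite leNgt bt.
  + move=> s; rewrite /= !in_itv /= => /andP[as_ sc] sbt.
    have sb : b < s by move: sbt; rewrite ltr_norml => /andP[+ _]; lra.
    by rewrite sc (ltW sb) leNgt sb.
  + by apply: hy; rewrite tc ltW.
- subst t; apply: (@has_deriv_withinS _ _ (`[a, b] `|` `[b, c])).
    move=> s; rewrite /= !in_itv /= => /andP[as_ sc].
    by have [sb|/ltW bs] := leP s b; [left; rewrite as_|right; rewrite bs].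
  apply: has_deriv_withinU.
    apply: (@has_deriv_within_near _ _ `[a, b] _ x _ _ _ 1) => //.
      by rewrite lexx.
    by move=> s; rewrite /= in_itv /= => /andP[as_ sb] _; rewrite sb as_.
    by apply: hx; rewrite at_ lexx.
  apply: (@has_deriv_within_near _ _ `[b, c] _ y _ _ _ 1) => //.
    by rewrite lexx.
  move=> s; rewrite /= in_itv /= => /andP[bs sc] _; split=> //.
    by rewrite bs.
  by case: ifPn => // sb; have <- : b = s by apply: le_anti; rewrite bs.
  by rewrite xyb; apply: hy; rewrite tc lexx.
Qed.

Lemma halving_small (R : realType) (C e : R) : 0 < e -> exists N, C / 2 ^+ N <= e.
Proof.
move=> e0; exists (Num.bound (`|C| / e)).
have := archi_boundP (divr_ge0 (normr_ge0 C) (ltW e0)).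
set N := Num.bound _; rewrite ltr_pdivrMr// => CN.
rewrite ler_pdivrMr ?exprn_gt0// (le_trans (ler_norm _))// (le_trans (ltW CN))//.
by rewrite mulrC ler_wpM2l ?(ltW e0)// -natrX ler_nat ltnW// ltn_expl.
Qed.

(** * Ordinary differential equations *)

Section picard.
Context (R : realType) (H : completeNormedModType R) (ip : {dot H for idfun}).
Hypothesis ip_norm : forall u : H, `|u| ^+ 2 = ip u u.
Variables (F : R -> H -> H) (L K : R).
Hypotheses (L0 : 0 <= L) (Fc : forall y : R -> H, continuous y -> continuous (fun t => F t (y t)))
  (FL : forall t u v, `|F t u - F t v| <= L * `|u - v|)
  (FK : forall t u, `|F t u| <= K).

(** The condition on [L * delta] makes the integral operator [T] halve uniform distances on the
    interval [I], so its iterates converge geometrically. *)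
Lemma picard (a delta : R) (y0 : H) : 0 <= delta -> L * delta <= 2^-1 ->
  exists2 y : R -> H, y a = y0 & forall t, a <= t <= a + delta ->
    has_deriv_within `[a, a + delta] y t (F t (y t)).
Proof.
move=> d0 Ld; have K0 : 0 <= K by exact: le_trans (normr_ge0 _) (FK 0 0).
pose I := [set t | a <= t <= a + delta].
have ex (y : R -> H) : exists z : R -> H, continuous y -> [/\ continuous z, z a = y0 &
    forall t, a <= t -> has_deriv_within `[a, +oo[ z t (F t (y t))].
  have [/Fc yc|] := pselect (continuous y); last by exists y.
  by have [z [? ? ?]] := hilbert_primitive ip_norm a y0 yc; exists z.
have [T hT] := choice ex.
have step (y y' : R -> H) B : continuous y -> continuous y' ->
    (forall t, I t -> `|y t - y' t| <= B) ->
    forall t, I t -> `|T y t - T y' t| <= B / 2.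
  move=> yc yc' hB t /andP[at_ ta].
  have [Tc Ta Td] := hT y yc; have [Tc' Ta' Td'] := hT y' yc'.
  have B0 : 0 <= B by apply: le_trans (hB a _); rewrite // /I /= lexx lerDl.
  have : `|(T y t - T y' t) - (T y a - T y' a) - (t - a) *: 0| <= L * B * (t - a).
    apply: (@mean_value_le _ _ a t _ (fun t => T y t - T y' t)
      (fun t => F t (y t) - F t (y' t))) => // r /andP[ar rt].
      have S : `[a, t] `<=` `[a, +oo[%classic.
        by move=> s; rewrite /= !in_itv /= andbT => /andP[].
      by apply: has_deriv_withinB; apply: (has_deriv_withinS S);
        [exact: Td|exact: Td'].
    rewrite subr0 (le_trans (FL _ _ _))// ler_wpM2l// hB// /I /= ar.
    exact: le_trans ta.
  rewrite Ta Ta' subrr subr0 scaler0 subr0 => /le_trans; apply.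
  have : L * (t - a) <= L * delta by rewrite ler_wpM2l//; lra.
  nra.
pose y_ n := iter n T (fun=> y0).
have yc n : continuous (y_ n).
  elim: n => [|n ih]; first by move=> t; exact: cvg_cst.
  by have [] := hT _ ih.
have y_Sd n t : a <= t -> has_deriv_within `[a, +oo[ (y_ n.+1) t (F t (y_ n t)).
  by have [_ _] := hT _ (yc n); exact.
pose C := K * delta.
have C0 : 0 <= C by rewrite mulr_ge0.
have step_n n t : I t -> `|y_ n.+1 t - y_ n t| <= C / 2 ^+ n.
  elim: n t => [|n ih] t.
    move=> /andP[at_ ta].
    have : `|y_ 1%N t - y_ 1%N a - (t - a) *: 0| <= K * (t - a).
      apply: (@mean_value_le _ _ a t K (y_ 1%N) (fun t => F t (y_ 0%N t))) => //.
        move=> r /andP[ar rt]; apply: has_deriv_withinS (y_Sd 0%N r ar).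
        by move=> s; rewrite /= !in_itv /= andbT => /andP[].
      by move=> r _; rewrite subr0.
    have -> : y_ 1%N a = y0 by have [] := hT _ (yc 0%N).
    rewrite scaler0 subr0 expr0 divr1 => /le_trans; apply.
    by rewrite ler_wpM2l// lerBlDl.
  move=> It; have := step _ _ _ (yc n.+1) (yc n) ih t It.
  by rewrite exprSr invfM mulrA.
have step_nk n k t : I t -> `|y_ (n + k)%N t - y_ n t| <= 2 * C / 2 ^+ n.
  move=> It; elim: k n => [|k ih] n.
    by rewrite addn0 subrr normr0 divr_ge0// mulr_ge0.
  rewrite addnS -addSn -(subrK (y_ n.+1 t) (y_ (n.+1 + k)%N t)) -addrA.
  apply: le_trans (ler_normD _ _) _.
  apply: le_trans (lerD (ih n.+1) (step_n n t It)) _.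
  rewrite exprS invfM; set q := (2 ^+ n)^-1; lra.
have exY t : exists l : H, I t -> y_ n t @[n --> \oo] --> l.
  have [It|] := pselect (I t); last by exists 0.
  have [l hl] : exists l : H, y_ n t @[n --> \oo] --> l; last by exists l.
  apply: cauchy_osc_cvg => e e0.
  have [N hN] := halving_small (4 * C) e0.
  exists [set n | (N <= n)%N]; first by exists N.
  move=> m n /= Nm Nn.
  have hm := step_nk N (m - N)%N t It; have hn := step_nk N (n - N)%N t It.
  rewrite subnKC// in hm; rewrite subnKC// in hn.
  apply: le_trans hN; rewrite -(subrKA (y_ N t)).
  apply: le_trans (ler_normD _ _) _; rewrite (distrC (y_ N t)).
  have -> : 4 * C / 2 ^+ N = 2 * C / 2 ^+ N + 2 * C / 2 ^+ N by field; rewrite expf_neq0.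
  exact: lerD.
have [Y0 hY0] := choice exY.
have Y0n n t : I t -> `|Y0 t - y_ n t| <= 2 * C / 2 ^+ n.
  move=> It; apply/ler_addgt0Pr => e e0.
  have /cvgrPdist_lt/(_ _ e0) := hY0 t It.
  move=> -[m _ hm]; have := hm (n + m)%N (leq_addl _ _) => /= h1.
  rewrite -(subrKA (y_ (n + m)%N t)) (le_trans (ler_normD _ _))// addrC.
  exact: lerD (step_nk _ _ _ It) (ltW h1).
(* Clamping time to [I] turns the limit, controlled on [I] only, into a function continuous on the
   whole line, to which [T] can be applied. *)
pose cl t := Num.max a (Num.min (a + delta) t).
have Icl t : I (cl t).
  by rewrite /I /cl /= le_max lexx /= ge_max ge_min lexx lerDl d0.
have clI t : I t -> cl t = t.
  by move=> /andP[at_ ta]; rewrite /cl (min_idPr ta) (max_idPr at_).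
have clc : continuous cl.
  move=> t; apply: continuous_max; first exact: cvg_cst.
  by apply: continuous_min; [exact: cvg_cst|exact: cvg_id].
have Yc : continuous (fun t => Y0 (cl t)).
  move=> t; apply/cvgrPdist_le => e e0.
  have e3 : 0 < e / 3 by rewrite divr_gt0.
  have [n hn] := halving_small (2 * C) e3.
  have : y_ n (cl s) @[s --> t] --> y_ n (cl t).
    by apply: continuous_comp; [exact: clc|exact: yc].
  move=> /cvgrPdist_le/(_ _ e3); apply: filterS => s hs.
  have h1 := le_trans (Y0n n _ (Icl t)) hn.
  have h2 := le_trans (Y0n n _ (Icl s)) hn.
  rewrite -(subrKA (y_ n (cl t))) -[X in _ + X](subrKA (y_ n (cl s))).
  rewrite (le_trans (ler_normD _ _))//.
  have := ler_normD (y_ n (cl t) - y_ n (cl s)) (y_ n (cl s) - Y0 (cl s)).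
  rewrite (distrC _ (Y0 (cl s))); lra.
have [Zc Za Zd] := hT _ Yc.
set Z := T _ in Zc Za Zd.
(* [Z], the image under [T] of the clamped limit, is differentiable by construction. It agrees with
   the limit on [I] because both are arbitrarily close to the iterates. *)
have ZY t : I t -> Z t = Y0 t.
  move=> It; apply/eqP; rewrite -subr_eq0 -normr_le0.
  apply/ler_addgt0Pr => e e0; rewrite add0r.
  have [n hn] := halving_small (3 * C) e0.
  have h1 : `|Z t - y_ n.+1 t| <= 2 * C / 2 ^+ n / 2.
    apply: step It => //.
    by move=> r Ir; rewrite clI//; exact: Y0n.
  have h2 := Y0n n.+1 t It.
  rewrite -(subrKA (y_ n.+1 t)) (le_trans (ler_normD _ _))//.
  rewrite (distrC _ (Y0 t)); apply: le_trans (lerD h1 h2) _.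
  apply: le_trans hn; rewrite exprS invfM.
  have : 0 <= (2 ^+ n)^-1 :> R by rewrite invr_ge0 exprn_ge0.
  set q := (2 ^+ n)^-1; nra.
exists Z => // t It; rewrite ZY//.
have := Zd t; rewrite clI//; case/andP: It => at_ ta /(_ at_).
apply: has_deriv_withinS => s.
by rewrite /= !in_itv /= andbT => /andP[].
Qed.

End picard.

Lemma closed_ball_convex (R : realType) (V : normedModType R) (x : V) (r : R) :
  convex_set (closed_ball_ Num.norm x r : set (convex_lmodType V)).
Proof.
move=> u v l; rewrite !inE /closed_ball_ /= => ur vr.
have -> : x - (l%:num *: u + (1 - l%:num) *: v) =
    l%:num *: (x - u) + (1 - l%:num) *: (x - v).
  rewrite !scalerBr addrACA -opprD -scalerDl.
  by rewrite subrKC scale1r.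
have l0 : 0 <= l%:num by [].
have l1 : l%:num <= 1 by [].
apply: le_trans (ler_normD _ _) _; rewrite !normrZ !ger0_norm ?subr_ge0//.
move: l0 l1; set k := l%:num; nra.
Qed.

Section ode.
Context (R : realType) (H : completeNormedModType R) (ip : {dot H for idfun}).
Hypothesis ip_norm : forall u : H, `|u| ^+ 2 = ip u u.
Variable F : R -> H -> H.

(** Nothing in the Lipschitz condition controls the dependence on time, so the local bound [K] is
    part of the predicate; it limits how fast a solution can leave the ball. *)
Definition locally_lipschitz_field := forall T x, exists L K r : R,
  [/\ 0 <= L, 0 < r & forall t, `|t - T| <= r ->
    (forall u v, `|x - u| <= r -> `|x - v| <= r ->
      `|F t u - F t v| <= L * `|u - v|) /\
    (forall u, `|x - u| <= r -> `|F t u| <= K)].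

Hypotheses (Fc : forall (s : R -> R) (y : R -> H), continuous s -> continuous y ->
  continuous (fun t => F (s t) (y t))) (Floc : locally_lipschitz_field).

(* The length of the interval of existence is uniform near [(T, x)], so that
   solutions starting slightly before [T] reach beyond [T]. *)
Lemma local_existence (T : R) (x : H) : exists delta rho : R,
  [/\ 0 < delta, 0 < rho & forall a y0, T - delta <= a <= T -> `|x - y0| <= rho ->
    exists2 y : R -> H, y a = y0 & forall t, a <= t <= a + 2 * delta ->
      has_deriv_within `[a, a + 2 * delta] y t (F t (y t))].
Proof.
have [L [K [r [L0 r0 hF]]]] := Floc T x.
pose B := closed_ball_ Num.norm x r : set H.
have Bx : B x by rewrite /B /closed_ball_ /= subrr normr0 ltW.
have Bcl : closed B by exact: closed_closed_ball_.
have Bcv : convex_set B by exact: closed_ball_convex.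
have B0 : B !=set0 by exists x.
have Bp u : B (metric_proj B u) by exact: (metric_proj_in ip_norm).
have K0 : 0 <= K.
  have [|_ h] := hF T; first by rewrite subrr normr0 ltW.
  exact: le_trans (normr_ge0 _) (h x Bx).
pose cl t := Num.max (T - r) (Num.min (T + r) t).
have clr t : `|cl t - T| <= r.
  have h1 : T - r <= cl t by rewrite le_max lexx.
  have h2 : cl t <= T + r by rewrite ge_max ge_min lexx /= andbT; lra.
  by rewrite ler_norml; apply/andP; split; lra.
have clE t : T - r <= t <= T + r -> cl t = t.
  by move=> /andP[h1 h2]; rewrite /cl (min_idPr h2) (max_idPr h1).
have clc : continuous cl.
  move=> t; apply: (@continuous_max R R (fun=> T - r) (fun s => Num.min (T + r) s)).
    exact: cvg_cst.
  by apply: (@continuous_min R R (fun=> T + r) id); [exact: cvg_cst|exact: cvg_id].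
(* Clamped in time and precomposed with the projection onto [B], the field is bounded by [K] and,
   the projection being nonexpansive, globally [L]-Lipschitz. It agrees with [F] for times within
   [r] of [T] and states in [B]. *)
pose G t u := F (cl t) (metric_proj B u).
have Pc : continuous (metric_proj B) by exact: (metric_proj_continuous ip_norm).
have Gc (y : R -> H) : continuous y -> continuous (fun t => G t (y t)).
  move=> yc; apply: Fc => // t.
  by apply: continuous_comp; [exact: yc|exact: Pc].
have GL t u v : `|G t u - G t v| <= L * `|u - v|.
  have [h _] := hF _ (clr t).
  apply: le_trans (h _ _ (Bp u) (Bp v)) _; rewrite ler_wpM2l//.
  exact: (metric_proj_nonexp ip_norm).
have GK t u : `|G t u| <= K.
  by have [_ h] := hF _ (clr t); exact/h/Bp.
(* Solutions live for a time [2 * delta]. The first bound keeps these times within [r] of [T], the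
   second gives [L * (2 * delta) <= 2^-1] for Picard, and the third limits the displacement to
   [r / 2], so that a start within [r / 2] of [x] stays in [B]. *)
pose delta := Num.min (r / 2) (Num.min (4 * (L + 1))^-1 (r / (4 * (K + 1)))).
have d0 : 0 < delta.
  by rewrite !lt_min !divr_gt0 ?invr_gt0 ?mulr_gt0//; lra.
have dr : delta <= r / 2 by rewrite ge_min lexx.
have dL : delta * (4 * (L + 1)) <= 1.
  rewrite -ler_pdivlMr; last by rewrite mulr_gt0//; lra.
  by rewrite div1r !ge_min lexx orbT.
have dK : delta * (4 * (K + 1)) <= r.
  rewrite -ler_pdivlMr; last by rewrite mulr_gt0//; lra.
  by rewrite !ge_min lexx !orbT.
exists delta, (r / 2); split=> //; first lra.
move=> a y0 /andP[Ta aT] xy0.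
have [||y ya hy] := picard ip_norm L0 Gc GL GK a y0 (delta := 2 * delta); first lra.
  by nra.
exists y => // t /andP[at_ ta].
have yB : B (y t).
  have h : `|y t - y a - (t - a) *: 0| <= K * (t - a).
    apply: (@mean_value_le _ _ a t K y (fun t => G t (y t))) => //.
      move=> s /andP[as_ st]; apply: (@has_deriv_withinS _ _ `[a, a + 2 * delta]).
        move=> q; rewrite /= !in_itv /= => /andP[-> qt] /=.
        exact: le_trans ta.
      by apply: hy; rewrite as_ (le_trans st).
    by move=> s _; rewrite subr0.
  rewrite ya scaler0 subr0 distrC in h.
  rewrite /B /closed_ball_ /= -(subrKA y0) (le_trans (ler_normD _ _))//.
  have : K * (t - a) <= K * (2 * delta) by rewrite ler_wpM2l//; lra.
  nra.
have := hy t; rewrite at_ ta => /(_ isT).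
rewrite /G clE; last by apply/andP; split; lra.
by rewrite (metric_proj_id ip_norm Bcl Bcv B0).
Unshelve. all: by end_near. Qed.

(** Real induction. To the right of a time of agreement, on an interval with [L * (s - t) <= 2^-1],
    the mean value inequality halves any uniform bound of the difference, in place of Gronwall's
    lemma; at a left limit continuity suffices. *)
Lemma ode_unique (a b : R) (x y : R -> H) : x a = y a ->
  (forall t, a <= t <= b -> has_deriv_within `[a, b] x t (F t (x t))) ->
  (forall t, a <= t <= b -> has_deriv_within `[a, b] y t (F t (y t))) ->
  forall t, a <= t <= b -> x t = y t.
Proof.
move=> xya hx hy; apply: real_induction => //.
- move=> t /andP[at_ tb] xyt.
  have tab : a <= t <= b by rewrite at_ ltW.
  have xyt0 : x t = y t by apply: xyt; rewrite at_ lexx.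
  have [L [K [r [L0 r0 hF]]]] := Floc t (x t).
  have [d1 d10 hd1] := has_deriv_within_cvg (hx t tab) r0.
  have [d2 d20 hd2] := has_deriv_within_cvg (hy t tab) r0.
  pose d := Num.min (Num.min d1 d2) (Num.min r (2 * (L + 1))^-1).
  have d0 : 0 < d by rewrite !lt_min d10 d20 r0 invr_gt0 mulr_gt0//; lra.
  have dd1 : d <= d1 by rewrite !ge_min lexx.
  have dd2 : d <= d2 by rewrite !ge_min lexx !orbT.
  have dr : d <= r by rewrite !ge_min lexx !orbT.
  have dL : d * (2 * (L + 1)) <= 1.
    rewrite -ler_pdivlMr; last by rewrite mulr_gt0//; lra.
    by rewrite div1r !ge_min lexx !orbT.
  have nx s : t <= s < t + d -> s <= b -> `|x t - x s| <= r /\ `|x t - y s| <= r.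
    move=> /andP[ts sd] sb.
    have sab : `[a, b]%classic s by rewrite /= in_itv /= sb (le_trans at_).
    have st : `|s - t| < d by rewrite ger0_norm ?subr_ge0//; lra.
    split; first by rewrite distrC ltW// hd1// (lt_le_trans st).
    by rewrite xyt0 distrC ltW// hd2// (lt_le_trans st).
  have key n s : t <= s < t + d -> s <= b -> `|x s - y s| <= 2 * r / 2 ^+ n.
    elim: n s => [|n ih] s tsd sb.
      have [h1 h2] := nx s tsd sb.
      rewrite expr0 divr1 -(subrKA (x t)) (le_trans (ler_normD _ _))//.
      by rewrite distrC; lra.
    have /andP[ts sd] := tsd.
    have : `|(x s - y s) - (x t - y t) - (s - t) *: 0| <= L * (2 * r / 2 ^+ n) * (s - t).
      apply: (@mean_value_le _ _ t s _ (fun s => x s - y s)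
        (fun s => F s (x s) - F s (y s))) => //.
        move=> q /andP[tq qs].
        have qab : a <= q <= b by rewrite (le_trans at_ tq) (le_trans qs).
        have S : `[t, s] `<=` `[a, b]%classic.
          move=> p; rewrite /= !in_itv /= => /andP[tp ps].
          by rewrite (le_trans at_ tp) (le_trans ps).
        by apply: has_deriv_withinB; apply: (has_deriv_withinS S);
          [exact: hx|exact: hy].
      move=> q /andP[tq qs]; rewrite subr0.
      have tqd : t <= q < t + d by rewrite tq (le_lt_trans qs).
      have qb := le_trans qs sb.
      have [|h _] := hF q; first by rewrite ger0_norm ?subr_ge0//; lra.
      have [h1 h2] := nx q tqd qb.
      by apply: le_trans (h _ _ h1 h2) _; rewrite ler_wpM2l// ih.
    rewrite xyt0 subrr subr0 scaler0 subr0 => /le_trans; apply.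
    rewrite exprS invfM.
    have : 0 <= 2 * r / 2 ^+ n by rewrite divr_ge0 ?exprn_ge0//; lra.
    have -> : 2 * r * (2^-1 / 2 ^+ n) = 2 * r / 2 ^+ n / 2.
      by rewrite mulrCA mulrC.
    set q := 2 * r / 2 ^+ n => q0.
    have : L * (s - t) <= 2^-1.
      apply: (@le_trans _ _ (L * d)); first by rewrite ler_wpM2l//; lra.
      nra.
    nra.
  exists d => // s /andP[ts sd] sb; apply/eqP; rewrite -subr_eq0 -normr_le0.
  apply/ler_addgt0Pr => e e0; rewrite add0r.
  have [n hn] := halving_small (2 * r) e0.
  by apply: le_trans hn; apply: key; rewrite ?(ltW ts).
- move=> t /andP[at_ tb] xyt.
  have tab : a <= t <= b by rewrite ltW.
  apply/eqP; rewrite -subr_eq0 -normr_le0.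
  apply/ler_addgt0Pr => e e0; rewrite add0r.
  have e2 : 0 < e / 2 by rewrite divr_gt0.
  have [d1 d10 hd1] := has_deriv_within_cvg (hx t tab) e2.
  have [d2 d20 hd2] := has_deriv_within_cvg (hy t tab) e2.
  pose s := Num.max a (Num.max (t - d1 / 2) (t - d2 / 2)).
  have st : s < t by rewrite !gt_max at_ /=; apply/andP; split; lra.
  have as_ : a <= s by rewrite !le_max lexx.
  have s1 : t - d1 / 2 <= s by rewrite !le_max lexx orbT.
  have s2 : t - d2 / 2 <= s by rewrite !le_max lexx !orbT.
  have sab : `[a, b]%classic s by rewrite /= in_itv /= as_ (le_trans (ltW st)).
  have := hd1 s sab; have := hd2 s sab.
  rewrite distrC gtr0_norm ?subr_gt0// => h2 h1.
  have {}h2 := h2 ltac:(lra); have {}h1 := h1 ltac:(lra).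
  rewrite -(subrKA (x s)) (le_trans (ler_normD _ _))// (distrC (x t)).
  rewrite xyt ?as_// in h1 *.
  lra.
Qed.

(** Real induction on [P b], existence on the closed interval [0, b]. Local existence gives the
    right step, the a priori limit gives the left one, and uniqueness merges solutions on different
    intervals into one. *)
Lemma global_existence (x0 : H) :
  (forall (b : R) (x : R -> H), 0 < b -> x 0 = x0 ->
    (forall t, 0 <= t < b -> has_deriv_within `[0, b[ x t (F t (x t))) ->
    exists l : H, x t @[t --> b^'-] --> l) ->
  exists2 x : R -> H, x 0 = x0 & forall t, 0 <= t ->
    has_deriv_within `[0, +oo[ x t (F t (x t)).
Proof.
move=> apriori.
pose P b := exists2 x : R -> H, x 0 = x0 &
  forall t, 0 <= t <= b -> has_deriv_within `[0, b] x t (F t (x t)).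
(* Solutions on the intervals [0, s] with s < b patch together on [0, b). *)
have patch (D : set R) : (forall t, D t -> 0 <= t /\ exists2 u, t < u & P u) ->
    exists2 x : R -> H, x 0 = x0 &
      forall t, D t -> has_deriv_within D x t (F t (x t)).
  move=> DP.
  have ex t : exists ux : R * (R -> H), D t -> [/\ t < ux.1, ux.2 0 = x0 &
      forall s, 0 <= s <= ux.1 -> has_deriv_within `[0, ux.1] ux.2 s (F s (ux.2 s))].
    have [Dt|] := pselect (D t); last by exists (0, fun=> 0).
    by have [_ [u tu [x x00 hx]]] := DP t Dt; exists (u, x).
  have [X hX] := choice ex.
  exists (fun t => if pselect (D t) then (X t).2 t else x0).
    by case: pselect => // D0; have [] := hX 0 D0.
  move=> t Dt; have [t0 _] := DP t Dt; have [tu x00 hx] := hX t Dt.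
  case: pselect => //= _.
  apply: (@has_deriv_within_near _ _ `[0, (X t).1] _ (X t).2 _ _ _ ((X t).1 - t)).
  - by rewrite subr_gt0.
  - by case: pselect.
  - move=> s Ds sd; have [s0 _] := DP s Ds; have [su x01 hs] := hX s Ds.
    have su2 : s <= (X t).1 by move: sd; rewrite ltr_norml => /andP[_]; lra.
    rewrite /= in_itv /= s0; split=> //; case: pselect => //= _.
    have S (w : R) : s <= w -> `[0, s] `<=` `[0, w]%classic.
      move=> sw p; rewrite /= !in_itv /= => /andP[-> ps] /=.
      exact: le_trans sw.
    apply: (@ode_unique 0 s); rewrite ?s0 ?lexx ?x00 ?x01// => p /andP[p0 ps].
      by apply: (has_deriv_withinS (S _ su2)); apply: hx; rewrite p0 (le_trans ps).
    apply: (has_deriv_withinS (S _ (ltW su))); apply: hs.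
    by rewrite p0 (le_trans ps (ltW su)).
  - by apply: hx; rewrite t0 ltW.
(* Serves both induction steps: to the right with [T = a] and [l = x a], at a left limit with [l]
   the a priori limit and [a] slightly before [T]. As [a >= T - delta], a local solution of length
   [2 * delta] reaches [T + delta]. *)
have extend (T a : R) (l : H) (x : R -> H) delta rho : 0 <= a -> 0 < delta ->
    (forall c y0, T - delta <= c <= T -> `|l - y0| <= rho ->
      exists2 y : R -> H, y c = y0 & forall t, c <= t <= c + 2 * delta ->
      has_deriv_within `[c, c + 2 * delta] y t (F t (y t))) ->
    x 0 = x0 -> (forall t, 0 <= t <= a -> has_deriv_within `[0, a] x t (F t (x t))) ->
    T - delta <= a <= T -> `|l - x a| <= rho ->
    forall b, 0 <= b <= T + delta -> P b.
  move=> a0 d0 loc xx0 hx aT lx b /andP[b0 bT].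
  have [y ya hy] := loc a (x a) aT lx.
  have aad : a <= a + 2 * delta by lra.
  have hz := has_deriv_within_glue a0 aad (esym ya) hx hy.
  set z := fun t => _ in hz.
  have bad : b <= a + 2 * delta by move/andP : aT => [? _]; lra.
  exists z; first by rewrite /z a0.
  move=> t /andP[t0 tb].
  apply: (@has_deriv_withinS _ _ `[0, a + 2 * delta]).
    move=> p; rewrite /= !in_itv /= => /andP[-> pb] /=.
    exact: le_trans bad.
  by apply: hz; rewrite t0 (le_trans tb).
have all_P b : 0 <= b -> P b.
  move=> b0; apply: (@real_induction _ 0 b P); last by rewrite b0 lexx.
  - exists (fun t => x0 + t *: F 0 x0); first by rewrite scale0r addr0.
    move=> t /andP[t0 t1]; have -> : t = 0 by apply: le_anti; rewrite t1.
    move=> e e0; exists 1 => // s; rewrite /= in_itv /= => /andP[s0 s1] _.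
    have -> : s = 0 by apply: le_anti; rewrite s1.
    by rewrite !subrr scale0r subrr !normr0 mulr0.
  - move=> t /andP[t0 tb] Pt.
    have [x xx0 hx] : P t by apply: Pt; rewrite t0 lexx.
    have [delta [rho [d0 r0 loc]]] := local_existence t (x t).
    exists delta => // s /andP[ts std] _.
    apply: (extend _ _ _ _ _ _ t0 d0 loc xx0 hx).
    + by rewrite lexx andbT; lra.
    + by rewrite subrr normr0 ltW.
    + by rewrite (le_trans t0 (ltW ts)) ltW.
  - move=> t /andP[t0 tb] Pt.
    have [|x xx0 hx] := patch `[0, t[%classic.
      move=> s; rewrite /= in_itv /= => /andP[s0 st]; split=> //.
      by exists ((s + t) / 2); [lra|apply: Pt; apply/andP; split; lra].
    have {}hx s : 0 <= s < t -> has_deriv_within `[0, t[ x s (F s (x s)).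
      by move=> st; apply: hx; rewrite /= in_itv.
    have [l xl] := apriori t x t0 xx0 hx.
    have [delta [rho [d0 r0 loc]]] := local_existence t l.
    have /cvgrPdist_lt/(_ _ r0) := xl.
    rewrite near_withinE => /nbhs_ballP[e /= e0 he].
    pose a := Num.max 0 (Num.max (t - e / 2) (t - delta)).
    have a_lt : a < t by rewrite !gt_max t0 /=; apply/andP; split; lra.
    have a0 : 0 <= a by rewrite !le_max lexx.
    have ae : t - e / 2 <= a by rewrite !le_max lexx orbT.
    have ad : t - delta <= a by rewrite !le_max lexx !orbT.
    apply: (extend t a l x delta rho a0 d0 loc xx0).
    + move=> s /andP[s0 sa].
      apply: (@has_deriv_withinS _ _ `[0, t[).
        move=> p; rewrite /= !in_itv /= => /andP[-> pa] /=.
        exact: le_lt_trans a_lt.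
      by apply: hx; rewrite s0 (le_lt_trans sa).
    + by rewrite ad ltW.
    + apply/ltW; apply: he => //.
      by rewrite -ball_normE /ball_ /= gtr0_norm ?subr_gt0//; lra.
    + by rewrite (ltW t0) /=; lra.
have [|x xx0 hx] := patch `[0, +oo[%classic.
  move=> t; rewrite /= in_itv /= andbT => t0; split=> //.
  by exists (t + 1); [lra|apply: all_P; lra].
by exists x => // t t0; apply: hx; rewrite /= in_itv /= t0.
Qed.

End ode.

(** * Absolute continuity and total variation *)

Section abs_continuity.
Context (R : realType).
Implicit Types (a b : R) (f : R -> R).

Lemma abs_continuous_fin a b f : abs_continuous a b f ->
  forall e : R, 0 < e -> exists2 d : R, 0 < d &
    forall (K : finType) (u v : K -> R),
      (forall i, a <= u i /\ u i <= v i /\ v i <= b) ->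
      trivIset setT (fun i => `]u i, v i[%classic) ->
      \sum_i (v i - u i) < d -> \sum_i `|f (v i) - f (u i)| < e.
Proof.
move=> acf e /acf[d d0 hd]; exists d => // K u v uv tuv suv.
rewrite (big_enum_val (fun i => `|f (v i) - f (u i)|)).
apply: (hd _ (fun k => u (enum_val k)) (fun k => v (enum_val k))) => //.
- move=> i j _ _ /(tuv _ _ I I); exact: enum_val_inj.
- by move: suv; rewrite (big_enum_val (fun i => v i - u i)).
Qed.

Lemma abs_continuous_dist a b f : abs_continuous a b f ->
  forall e : R, 0 < e -> exists2 d : R, 0 < d &
    forall s t, a <= s <= b -> a <= t <= b -> `|s - t| < d -> `|f s - f t| < e.
Proof.
move=> /abs_continuous_fin acf e /acf[d d0 hd]; exists d => // s t.
wlog st : s t / t <= s.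
  move=> wl sab tab; have [ts|/ltW st] := leP t s; first exact: wl.
  by rewrite distrC (distrC (f s)); exact: wl.
move=> /andP[as_ sb] /andP[at_ tb]; rewrite ger0_norm ?subr_ge0// => std.
have := hd unit (fun=> t) (fun=> s).
by rewrite !big_const card_unit /= !addr0; apply => // -[] [].
Qed.

(** Subdividing each interval keeps the family disjoint and its total length unchanged, so the
    modulus of absolute continuity applies to all pieces at once, indexed by the dependent pairs in
    [J]. *)
Lemma abs_continuous_partitions a b f : abs_continuous a b f ->
  forall e : R, 0 < e -> exists2 d : R, 0 < d &
    forall (K : finType) (u v : K -> R) (s : K -> seq R),
      (forall i, a <= u i /\ u i <= v i /\ v i <= b) ->
      trivIset setT (fun i => `]u i, v i[%classic) ->
      (forall i, itv_partition (u i) (v i) (s i)) ->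
      \sum_i (v i - u i) < d -> \sum_i variation (u i) (v i) f (s i) < e.
Proof.
move=> /abs_continuous_fin acf e /acf[d d0 hd]; exists d => // K u v s uv tuv ps suv.
pose x i (k : nat) := nth (v i) (u i :: s i) k.
pose J : finType := {i : K & 'I_(size (s i))}.
have ux i k : (k < (size (s i)).+1)%N -> u i <= x i k.
  by move=> ki; exact: itv_partition_nth_ge ki (ps i).
have xv i k : (k < (size (s i)).+1)%N -> x i k <= v i.
  by move=> ki; exact: itv_partition_nth_le ki (ps i).
have xx i k l : (l < (size (s i)).+1)%N -> (k <= l)%N -> x i k <= x i l.
  move=> li kl; rewrite /x lt_sorted_leq_nth ?inE//=.
    by have [] := ps i.
  exact: leq_ltn_trans kl li.
have varE i : variation (u i) (v i) f (s i) =
    \sum_(k < size (s i)) `|f (x i k.+1) - f (x i k)|.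
  by rewrite /variation big_mkord.
rewrite (eq_bigr _ (fun i _ => varE i)).
have := hd J (fun p => x (tag p) (tagged p)) (fun p => x (tag p) (tagged p).+1).
rewrite -(sig_big_dep xpredT (fun _ => xpredT)
  (fun i (k : 'I_(size (s i))) => x i k.+1 - x i k)).
rewrite -(sig_big_dep xpredT (fun _ => xpredT)
  (fun i (k : 'I_(size (s i))) => `|f (x i k.+1) - f (x i k)|)).
apply.
- move=> [i k] /=; have [? [? ?]] := uv i.
  have := ltn_ord k => ki.
  split; first by rewrite (le_trans _ (ux i k _))// ltnS ltnW.
  split; last by rewrite (le_trans (xv i k.+1 _)).
  exact: xx.
- move=> [i k] [j l] _ _ [t] /=; rewrite !in_itv /= => -[/andP[t1 t2] /andP[t3 t4]].
  have ki := ltn_ord k; have lj := ltn_ord l.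
  have ij : i = j.
    apply: (tuv i j) => //; exists t; rewrite /= !in_itv /=; split.
      by rewrite (le_lt_trans (ux i k _) t1) ?(lt_le_trans t2 (xv _ _ _))// ltnS ltnW.
    by rewrite (le_lt_trans (ux j l _) t3) ?(lt_le_trans t4 (xv _ _ _))// ltnS ltnW.
  subst j; congr (Tagged _ _); apply/val_inj => /=.
  have [kl|lk|//] := ltngtP (k : nat) l.
    have := xx i k.+1 l; rewrite ltnS ltnW// => /(_ isT kl) h.
    by have := lt_le_trans (lt_trans t3 t2) h; rewrite ltxx.
  have := xx i l.+1 k; rewrite ltnS ltnW// => /(_ isT lk) h.
  by have := lt_le_trans (lt_trans t1 t4) h; rewrite ltxx.
- apply: le_lt_trans suv; apply: ler_sum => i _.
  rewrite -(big_mkord xpredT (fun k => x i k.+1 - x i k)) telescope_sumr//.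
  by rewrite /x (itv_partition_nth_size _ (ps i)).
Qed.

(** On an interval shorter than the modulus for [e = 1] all variation sums are at most 1; real
    induction joins such intervals. *)
Lemma abs_continuous_BV a b f : a <= b -> abs_continuous a b f ->
  bounded_variation a b f.
Proof.
move=> ab /abs_continuous_partitions/(_ 1 ltr01)[d d0 hd].
have loc p q : a <= p -> p <= q -> q <= b -> q - p < d -> bounded_variation p q f.
  move=> ap pq qb pqd; exists 1 => _ [s ps <-].
  have := hd unit (fun=> p) (fun=> q) (fun=> s).
  rewrite !big_const card_unit /= !addr0 => h; apply/ltW/h => //.
  by move=> [] [].
have BVD p q r : p <= q -> q <= r -> bounded_variation p q f ->
    bounded_variation q r f -> bounded_variation p r f.
  move=> pq qr /(bounded_variationP f pq) h1 /(bounded_variationP f qr) h2.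
  apply/(bounded_variationP f (le_trans pq qr)).
  by rewrite (total_variationD f pq qr) fin_numD h1.
apply: (@real_induction R a b (fun t => bounded_variation a t f)).
- exact: bounded_variationxx.
- move=> t /andP[at_ tb] Pt; exists d => // s /andP[ts sd] sb.
  apply: (BVD _ t); rewrite ?(ltW ts)//; first by apply: Pt; rewrite at_ lexx.
  by apply: loc; rewrite ?(ltW ts)//; lra.
- move=> t /andP[at_ tb] Pt.
  pose s := Num.max a (t - d / 2).
  have as_ : a <= s by rewrite le_max lexx.
  have st : s < t by rewrite gt_max at_ /=; lra.
  have tds : t - d / 2 <= s by rewrite le_max lexx orbT.
  apply: (BVD _ s); rewrite ?(ltW st)//; first by apply: Pt; rewrite as_.
  by apply: loc; rewrite ?(ltW st)//; lra.
- by rewrite ab lexx.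
Qed.

Lemma abs_continuous_TV a b f : a <= b -> abs_continuous a b f ->
  abs_continuous a b (fun t => fine (total_variation a t f)).
Proof.
move=> ab acf e e0; have BV := abs_continuous_BV ab acf.
have e2 : 0 < e / 2 by rewrite divr_gt0.
have [d d0 hd] := abs_continuous_partitions acf e2.
exists d => // n u v uv tuv suv.
have TVfin p q : a <= p -> p <= q -> q <= b -> total_variation p q f \is a fin_num.
  move=> ap pq qb; apply/bounded_variationP => //.
  by apply: (bounded_variationr ap pq); apply: bounded_variationl BV => //; exact: le_trans pq.
(* Each of the [n] variations is approached by a partition up to [eta], for a total error of at most
   [e / 2]; the successor keeps the denominator nonzero. *)
pose eta := e / 2 / n.+1%:R.
have eta0 : 0 < eta by rewrite divr_gt0.
have ex i : exists s, itv_partition (u i) (v i) s /\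
    fine (total_variation (u i) (v i) f) <= variation (u i) (v i) f s + eta.
  have [ui [uvi vi]] := uv i; have fin := TVfin _ _ ui uvi vi.
  have [_ [_ [s ps <-] <-] hs] := ub_ereal_sup_adherent eta0 fin.
  exists s; split=> //; rewrite -lee_fin fineK// EFinD.
  by rewrite -leeBlDr// ltW.
have [s hs] := choice ex.
have := hd _ u v s uv tuv (fun i => (hs i).1) suv.
set S := \sum_(i < n) variation _ _ _ _ => hS.
have : \sum_(i < n) `|fine (total_variation a (v i) f) -
    fine (total_variation a (u i) f)| <= S + \sum_(i < n) eta.
  rewrite -big_split /=; apply: ler_sum => i _.
  have [ui [uvi vi]] := uv i.
  rewrite (total_variationD f ui uvi) fineD; last 2 first.
    exact: TVfin (lexx a) ui (le_trans uvi vi).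
    exact: TVfin ui uvi vi.
  rewrite addrAC subrr add0r ger0_norm; first by have [] := hs i.
  exact/fine_ge0/total_variation_ge0.
move=> /le_lt_trans; apply.
rewrite sumr_const card_ord -mulr_natr.
have : eta * n%:R <= e / 2.
  by rewrite /eta mulrAC ler_pdivrMr// ler_pM2l// ler_nat.
lra.
Qed.

End abs_continuity.

(** * Densities of absolutely continuous functions *)

Lemma bounded_open_interval (R : realType) (I : set R) (m M : R) :
  open I -> is_interval I -> I `<=` `]m, M[ ->
  exists p q, p <= q /\ I = `]p, q[%classic.
Proof.
move=> Io Ii ImM; have [->|/set0P I0] := eqVneq I set0.
  by exists 0, 0; rewrite lexx set_itvoo0.
have ub : has_ubound I.
  by exists M => x /ImM; rewrite /= in_itv /= => /andP[_ /ltW].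
have lb : has_lbound I.
  by exists m => x /ImM; rewrite /= in_itv /= => /andP[/ltW].
exists (inf I), (sup I); split.
  have [x Ix] := I0; apply: (@le_trans _ _ x); first exact: ge_inf.
  exact: ub_le_sup.
apply/seteqP; split=> x.
  move=> Ix; rewrite /= in_itv /=.
  have /nbhs_ballP[e /= e0 he] : nbhs x I by exact: open_nbhs_nbhs.
  have Il : I (x - e / 2).
    by apply: he; rewrite -ball_normE /ball_ /= opprB addrC subrK gtr0_norm; lra.
  have Ir : I (x + e / 2).
    apply: he; rewrite -ball_normE /ball_ /= opprD addrA subrr add0r normrN gtr0_norm; lra.
  have h1 : inf I <= x - e / 2 by exact: ge_inf.
  have h2 : x + e / 2 <= sup I by exact: ub_le_sup.
  by apply/andP; split; lra.
rewrite /= in_itv /= => /andP[ix xs].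
have [||y Iy hy] := @inf_adherent R I (x - inf I); first by rewrite subr_gt0.
  by [].
have [||z Iz hz] := @sup_adherent R I (sup I - x); first by rewrite subr_gt0.
  by [].
rewrite subrKC in hy; rewrite subKr in hz.
by apply: (Ii y z) => //; rewrite !ltW.
Qed.

Section abs_continuous_density.
Context (R : realType) (a b : R) (v : R -> R).
Hypotheses (ab : a <= b) (v_nd : {in `[a, b] &, {homo v : x y / x <= y}})
  (v_ac : abs_continuous a b v).
Notation mu := (@lebesgue_measure R).

Let cl (t : R) := Num.max a (Num.min b t).

Let cl_itv t : a <= cl t <= b.
Proof. by rewrite le_max lexx ge_max ab ge_min lexx. Qed.

Let cl_id t : a <= t <= b -> cl t = t.
Proof. by move=> /andP[at_ tb]; rewrite /cl (min_idPr tb) (max_idPr at_). Qed.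

Let cl_le s t : s <= t -> cl s <= cl t.
Proof.
move=> st; rewrite /cl ge_max le_max lexx /= le_max; apply/orP; right.
by rewrite le_min !ge_min lexx st orbT.
Qed.

Let cl_B s t : s <= t -> cl t - cl s <= t - s.
Proof.
move=> st; have [as_ _] := andP (cl_itv s).
have h1 : Num.min b t <= b by rewrite ge_min lexx.
have h2 : Num.min b t <= t by rewrite ge_min lexx orbT.
have h3 : Num.min b t - (t - s) <= Num.min b s by rewrite le_min; apply/andP; split; lra.
have h4 : Num.min b s <= cl s by rewrite le_max lexx orbT.
by rewrite lerBlDr ge_max; apply/andP; split; lra.
Qed.

(** The extension of [v] by constants outside [a, b], from which a Stieltjes measure on the line is
    formed. Since [cl] is monotone and does not stretch intervals, absolute continuity survives
    without restriction on the end points. *)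
Let G t := v (cl t).

Let G_nd : {homo G : s t / s <= t}.
Proof. by move=> s t st; apply: v_nd; rewrite ?in_itv /= ?cl_itv//; exact: cl_le. Qed.

Let G_ac : forall e : R, 0 < e -> exists2 d : R, 0 < d &
  forall (K : finType) (p q : K -> R), (forall i, p i <= q i) ->
    trivIset setT (fun i => `]p i, q i[%classic) ->
    \sum_i (q i - p i) < d -> \sum_i (G (q i) - G (p i)) < e.
Proof.
move=> e /(abs_continuous_fin v_ac)[d d0 hd]; exists d => // K p q pq tpq spq.
have := hd K (fun i => cl (p i)) (fun i => cl (q i)).
under [\sum_i `|_|]eq_bigr => i _ do rewrite ger0_norm ?subr_ge0 ?G_nd//.
apply.
- move=> i; have /andP[? ?] := cl_itv (p i); have /andP[? ?] := cl_itv (q i).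
  by split=> //; split=> //; exact: cl_le.
- move=> i j _ _ [t [/=]]; rewrite !in_itv /= => /andP[t1 t2] /andP[t3 t4].
  have key r s : cl r < t -> t < cl s -> r < t < s.
    move=> rt ts; have /andP[ar _] := cl_itv r; have /andP[_ sb] := cl_itv s.
    have ct : cl t = t.
      by apply: cl_id; rewrite (ltW (le_lt_trans ar rt)) (ltW (lt_le_trans ts sb)).
    apply/andP; split; rewrite ltNge; apply/negP => /cl_le; rewrite ct leNgt.
      by rewrite rt.
    by rewrite ts.
  by apply: tpq => //; exists t; rewrite /= !in_itv /=; split; exact: key.
- by apply: le_lt_trans spq; apply: ler_sum => i _; exact: cl_B.
Qed.

Let G_cont : continuous G.
Proof.
move=> t; apply/cvgrPdist_lt => e /G_ac[d d0 hd].
near=> s.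
have std : `|t - s| < d by near: s; apply: cvgr_dist_lt.
have := hd unit (fun=> Num.min s t) (fun=> Num.max s t).
rewrite !big_const card_unit /= !addr0.
have -> : Num.max s t - Num.min s t = `|t - s|.
  by rewrite maxEle minEle; case: (leP s t) => st;
    [rewrite ger0_norm ?subr_ge0|rewrite ltr0_norm ?subr_lt0 ?opprB].
have -> : G (Num.max s t) - G (Num.min s t) = `|G t - G s|.
  rewrite maxEle minEle; case: (leP s t) => st.
    by rewrite ger0_norm ?subr_ge0 ?G_nd.
  by rewrite distrC ger0_norm ?subr_ge0 ?G_nd ?ltW.
apply => //.
  by move=> _; rewrite ge_min !le_max lexx.
by move=> [] [].
Unshelve. all: by end_near. Qed.

(** Absolute continuity makes the Stieltjes measure of [G], restricted to (a, b] so as to be finite,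
    vanish on Lebesgue null sets; the density is its Radon-Nikodym derivative. *)
Lemma nondecreasing_abs_continuous_density : exists2 h : R -> R,
  mu.-integrable setT (EFin \o h) &
  forall x, a <= x <= b -> v x - v a = \int[mu]_(r in `[a, x]) h r.
Proof.
have Grc x : G @ at_right x --> G x by apply: cvg_within_filter; exact: G_cont.
pose Gc := isCumulative.Build R _ R G G_nd Grc.
pose C : cumulative R R := HB.pack G Gc.
pose nu := lebesgue_stieltjes_measure C.
have nuE p q : p <= q -> nu `]p, q]%classic = (G q - G p)%:E.
  move=> pq; rewrite /nu /lebesgue_stieltjes_measure /measure_extension.
  rewrite measurable_mu_extE/=; last exact: is_ocitv.
  by rewrite wlength_itv_bnd.
have mD : measurable (`]a, b]%classic : set (measurableTypeR R)) by exact: measurable_itv.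
have nuD : (nu `]a, b]%classic < +oo)%E by rewrite nuE// ltry.
pose nu' : {finite_measure set (measurableTypeR R) -> \bar R} := mfrestr mD nuD.
(* A null set is covered by an open [U] of small measure, a disjoint union of intervals. For
   finitely many of them absolute continuity bounds the sum of the increments of [G] by [e], and the
   bound passes to the series. *)
have dom : nu' `<< mu.
  apply/null_content_dominatesP => A mA muA0.
  rewrite /nu' /= /mfrestr /mrestr -/nu.
  have mAD : measurable (A `&` `]a, b]) by exact: measurableI.
  have muAD : mu (A `&` `]a, b]) = 0%E.
    by apply/eqP; rewrite -measure_le0 -muA0 le_measure ?inE//; exact: subIsetl.
  apply/eqP; rewrite -measure_le0.
  apply/lee_addgt0Pr => e e0; rewrite add0e.
  have [d d0 hd] := G_ac e0.
  have [U0 [oU0 AU0 muU0]] := lebesgue_regularity_outer mAD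
    (eq_ind_r (fun z => z < +oo)%E (ltry 0) muAD) d0.
  pose U := U0 `&` `]a - 1, b + 1[%classic.
  have oU : open U by apply: openI => //; exact: itv_open.
  have mU : measurable U by exact: measurable_realfun.open_measurable.
  have muU : (mu U < d%:E)%E.
    apply: le_lt_trans muU0.
    apply: (@le_trans _ _ (mu U0)).
      by rewrite le_measure ?inE//; [exact: measurable_realfun.open_measurable|exact: subIsetl].
    rewrite (measureDI mu (measurable_realfun.open_measurable oU0) mAD).
    rewrite -[leRHS]adde0 leeD2l// -muAD le_measure ?inE//.
      by apply: measurableI => //; exact: measurable_realfun.open_measurable.
  have AU : A `&` `]a, b] `<=` U.
    move=> x Ax; split; first exact: AU0.
    have [_] := Ax; rewrite /= !in_itv /= => /andP[ax xb].
    by apply/andP; split; lra.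
  pose J := open_disjoint_itv oU.
  have Jt : trivIset setT J by exact: open_disjoint_itv_trivIset.
  have JU : U = \bigcup_k J k by exact: open_disjoint_itv_bigcup.
  have ex k : exists pq : R * R, pq.1 <= pq.2 /\ J k = `]pq.1, pq.2[%classic.
    have [|||p [q [pq ->]]] := @bounded_open_interval R (J k) (a - 1) (b + 1).
    - exact: open_disjoint_itv_open.
    - exact: open_disjoint_itv_is_interval.
    - by move=> x Jx; have [] : U x by rewrite JU; exists k.
    - by exists (p, q).
  have [pq hpq] := choice ex.
  have mJ k : measurable (J k : set (measurableTypeR R)).
    by have [_ ->] := hpq k; exact: measurable_itv.
  apply: (@le_trans _ _ (nu U)); first by rewrite le_measure ?inE.
  have := @measure_semi_bigcup _ _ _ (lebesgue_stieltjes_measure C) J mJ Jt.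
  rewrite -JU => /(_ mU) nuU; rewrite [leLHS]nuU.
  apply: lime_le; first exact: is_cvg_nneseries.
  apply: nearW => n.
  have nuJ k : (nu (J k) <= (G (pq k).2 - G (pq k).1)%:E)%E.
    have [le_pq Jk] := hpq k.
    rewrite -nuE// le_measure ?inE//.
    rewrite Jk; exact: subset_itv_oo_oc.
  apply: (@le_trans _ _ (\sum_(0 <= k < n) (G (pq k).2 - G (pq k).1)%:E)%E).
    exact: lee_sum.
  rewrite sumEFin lee_fin big_mkord; apply/ltW.
  apply: (hd 'I_n (fun k => (pq k).1) (fun k => (pq k).2)).
  - by move=> k; have [] := hpq k.
  - move=> k l _ _; have [_ Jk] := hpq k; have [_ Jl] := hpq l.
    rewrite -Jk -Jl => kl; apply/val_inj; exact: (Jt k l).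
  - rewrite -lte_fin; apply: le_lt_trans muU.
    rewrite -sumEFin.
    have muJ k : ((pq k).2 - (pq k).1)%:E = mu (J k).
      have [le_pq ->] := hpq k; rewrite lebesgue_measure_itv /= lte_fin.
      move: le_pq; rewrite le_eqVlt => /predU1P[->|->]; last by rewrite EFinB.
      by rewrite ltxx subrr.
    rewrite (eq_bigr (fun k : 'I_n => mu (J k)) (fun k _ => muJ k)).
    rewrite -(measure_bigsetU mu mJ Jt n) le_measure ?inE//.
      by rewrite -bigcup_mkord; apply: bigcup_measurable => k _; exact: mJ.
    by rewrite JU -bigcup_mkord => x [k _ Jx]; exists k.
have [f [f0 ffin fint fE]] := radon_nikodym_sigma_finite dom.
have fint' : mu.-integrable setT (EFin \o (fine \o f)).
  by apply: eq_integrable fint => // x _ /=; rewrite fineK.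
exists (fine \o f) => // x /andP[ax xb].
have := fE `]a, x]%classic (measurable_itv _).
rewrite /nu' /= /mfrestr /mrestr setIidl; last first.
  by apply: subset_itvl; rewrite bnd_simp.
rewrite -/nu nuE// /G !cl_id ?lexx ?ax ?ab// => h.
rewrite -Rintegral_itv_obnd_cbnd; last exact: integrableS fint'.
apply: EFin_inj; rewrite h /Rintegral fineK; last first.
  by apply: integrable_fin_num => //; exact: integrableS fint'.
by apply: eq_integral => r _ /=; rewrite fineK.
Qed.

End abs_continuous_density.

(* The integral of a nonnegative function is a supremum over the simple functions
   below it, so that monotonicity needs no measurability. *)
Lemma ge0_le_integral_patch d (T : measurableType d) (R : realType)
    (mu : {measure set T -> \bar R}) (D1 D2 : set T) (f1 f2 : T -> \bar R) :
  (forall x, D1 x -> 0 <= f1 x)%E -> (forall x, D2 x -> 0 <= f2 x)%E ->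
  (forall x, (f1 \_ D1) x <= (f2 \_ D2) x)%E ->
  (\int[mu]_(x in D1) f1 x <= \int[mu]_(x in D2) f2 x)%E.
Proof.
move=> f10 f20 f12; rewrite !ge0_integralE//; apply: ereal_sup_le.
by move=> _ [h /= hf <-]; exists h => //= x; exact: le_trans (f12 x).
Qed.

Lemma dominated_total_variation (R : realType) (a b : R) (f A : R -> R) : a <= b ->
  (forall p q, a <= p -> p <= q -> q <= b -> `|f q - f p| <= A q - A p) ->
  (total_variation a b f <= (A b - A a)%:E)%E.
Proof.
move=> ab h; apply: ge_ereal_sup => _ [_ [s ps <-] <-]; rewrite lee_fin /variation.
apply: (@le_trans _ _ (\sum_(0 <= k < size s)
    (A (nth b (a :: s) k.+1) - A (nth b (a :: s) k)))).
  apply: ler_sum_nat => k /andP[_ ks]; apply: h.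
  - exact: itv_partition_nth_ge (ltnW ks) ps.
  - by case: ps => /(pathP b)/(_ k ks) /ltW + _.
  - by apply: (itv_partition_nth_le (m := k.+1)) ps.
rewrite (@telescope_sumr _ 0%N _ (fun k => A (nth b (a :: s) k)))//.
by rewrite (itv_partition_nth_size _ ps).
Qed.

Section abs_continuous_derivative.
Context (R : realType).
Notation mu := (@lebesgue_measure R).

(** Jordan decomposition [f = v - w] with [v] the variation function: increments of [f] are
    dominated by those of [v], so [w] is nondecreasing and its increments are at most twice those of
    [v]. Both parts then have densities. *)
Lemma abs_continuous_primitive (a b : R) (f : R -> R) : a <= b ->
  abs_continuous a b f -> exists2 k : R -> R, mu.-integrable setT (EFin \o k) &
    forall x, a <= x <= b -> f x - f a = \int[mu]_(r in `[a, x]) k r.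
Proof.
move=> ab acf; have acv := abs_continuous_TV ab acf.
set v := fun t => _ in acv.
have BV := abs_continuous_BV ab acf.
have TVfin p q : a <= p -> p <= q -> q <= b -> total_variation p q f \is a fin_num.
  move=> ap pq qb; apply/bounded_variationP => //.
  by apply: (bounded_variationr ap pq); apply: bounded_variationl BV => //; exact: le_trans pq.
have fv p q : a <= p -> p <= q -> q <= b -> `|f q - f p| <= v q - v p.
  move=> ap pq qb; rewrite /v (total_variationD f ap pq) fineD; last 2 first.
    exact: TVfin (lexx a) ap (le_trans pq qb).
    exact: TVfin ap pq qb.
  rewrite addrAC subrr add0r -lee_fin fineK; last exact: TVfin.
  exact: total_variation_ge.
have v_nd : {in `[a, b] &, {homo v : x y / x <= y}}.
  move=> x y; rewrite !in_itv /= => /andP[ax xb] /andP[ay yb] xy.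
  by rewrite -subr_ge0; apply: le_trans (fv x y ax xy yb).
pose w t := v t - f t.
have w_nd : {in `[a, b] &, {homo w : x y / x <= y}}.
  move=> x y; rewrite !in_itv /= => /andP[ax xb] /andP[ay yb] xy.
  have := le_trans (ler_norm _) (fv x y ax xy yb); rewrite /w; lra.
have acw : abs_continuous a b w.
  move=> e e0; have e2 : 0 < e / 2 by rewrite divr_gt0.
  have [d d0 hd] := acv _ e2; exists d => // n p q pq tpq spq.
  have h := hd n p q pq tpq spq.
  apply: (@le_lt_trans _ _ (2 * \sum_(i < n) `|v (q i) - v (p i)|)); last lra.
  rewrite mulr_sumr; apply: ler_sum => i _; have [ap [pqi qb]] := pq i.
  have h1 := fv _ _ ap pqi qb.
  have h2 : v (q i) - v (p i) <= `|v (q i) - v (p i)| by exact: ler_norm.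
  rewrite /w; have -> : v (q i) - f (q i) - (v (p i) - f (p i)) =
    (v (q i) - v (p i)) - (f (q i) - f (p i)) by ring.
  apply: le_trans (ler_normB _ _) _; lra.
have [hv hvint hvE] := nondecreasing_abs_continuous_density ab v_nd acv.
have [hw hwint hwE] := nondecreasing_abs_continuous_density ab w_nd acw.
exists (fun r => hv r - hw r).
  by apply: eq_integrable (integrableB _ hvint hwint).
move=> x axb; have /andP[ax xb] := axb.
rewrite RintegralB//; [|exact: integrableS hvint|exact: integrableS hwint].
by rewrite -hvE// -hwE// /w; ring.
Qed.

(** Almost everywhere on [a, b] the density [k] is the derivative of [f], by Lebesgue
    differentiation, and the variation is at most the integral of |k|. A larger [D] is allowed so
    that one integral over the half-line bounds the variations on all bounded intervals. *)
Lemma abs_continuous_TV_le (a b : R) (f : R -> R) (D : set R) : a <= b ->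
  `[a, b] `<=` D -> abs_continuous a b f ->
  (total_variation a b f <= \int[mu]_(t in D) `|derive1 f t|%:E)%E.
Proof.
move=> ab abD acf.
have [k kint kE] := abs_continuous_primitive ab acf.
have kint_itv p q : mu.-integrable `[p, q] (EFin \o k) by exact: integrableS kint.
have kint_itv' p q : mu.-integrable `[p, q] (EFin \o (fun r => `|k r|)).
  by have := integrable_abse (kint_itv p q).
pose A x := \int[mu]_(r in `[a, x]) `|k r|.
have fA p q : a <= p -> p <= q -> q <= b -> `|f q - f p| <= A q - A p.
  move=> ap pq qb.
  have -> : f q - f p = (f q - f a) - (f p - f a) by ring.
  rewrite !kE ?ap ?(le_trans ap pq) ?(le_trans pq qb)//.
  rewrite /A !Rintegral_itvB ?bnd_simp//.
  apply: le_normr_Rintegral => //.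
  by apply: integrableS (kint_itv p q) => //; apply: subset_itvr; rewrite bnd_simp.
apply: le_trans (dominated_total_variation ab fA) _.
have Aa : A a = 0 by rewrite /A set_itv1 Rintegral_set1.
rewrite Aa subr0 /A /Rintegral fineK; last first.
  by apply: integrable_fin_num => //; exact: kint_itv'.
have := @FTC1 _ k (BLeft a) (fun y => kint_itv a y)
  (open_integrable_locally openT kint).
move=> [N [mN N0 hN]].
(* The end points join the exceptional set because [derive1] is two-sided and depends there on
   values of [f] outside [a, b]. *)
pose N' := N `|` [set a] `|` [set b].
have mN' : measurable (N' : set (measurableTypeR R)).
  by apply: measurableU => //; apply: measurableU.
have N'0 : mu N' = 0%E.
  apply: measure_negligible => //; rewrite /N'.
  apply: negligibleU; last by apply/negligibleP => //; exact: lebesgue_measure_set1.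
  apply: negligibleU; last by apply/negligibleP => //; exact: lebesgue_measure_set1.
  by exists N; split.
rewrite (ge0_negligible_integral mN' _ _ _ N'0)//; last first.
  by have /integrableP[] := kint_itv' a b.
apply: ge0_le_integral_patch => // t.
rewrite [leLHS]patchE; case: ifPn => [|_]; last first.
  by rewrite patchE; case: ifPn => // _; rewrite lee_fin.
rewrite inE => -[tab tN'].
rewrite patchE ifT ?inE; last exact: abD.
move: tab; rewrite /= in_itv /= => /andP[at_ tb].
have ta : a < t.
  by rewrite lt_neqAle at_ andbT; apply/eqP => ta; apply: tN'; left; right.
have tltb : t < b.
  by rewrite lt_neqAle tb andbT; apply/eqP => tbE; apply: tN'; right.
have tN : ~ N t by move=> Nt; apply: tN'; left; left.
have [dK dKE] : derivable (fun x => \int[mu]_(r in [set` Interval (BLeft a) (BRight x)]) k r) t 1 /\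
    derive1 (fun x => \int[mu]_(r in [set` Interval (BLeft a) (BRight x)]) k r) t = k t.
  apply: contrapT => h; apply: tN; apply: hN => /= h'; apply: h; apply: h'.
  by rewrite lte_fin.
suff -> : derive1 f t = k t by [].
rewrite -dKE !derive1E.
have -> : 'D_1 (fun x => \int[mu]_(r in [set` Interval (BLeft a) (BRight x)]) k r) t =
   'D_1 (fun x => f x - f a) t.
  apply: near_eq_derive.
  have : t \in `]a, b[ by rewrite in_itv /= ta.
  move=> /(@near_in_itvoo R); apply: (@filterS _ (nbhs t)) => x.
  by rewrite in_itv /= => /andP[ax xb]; rewrite -kE// (ltW ax) (ltW xb).
apply: (congr1 (fun g : R -> R => lim (g @ 0^'))); apply/funext => h /=.
by congr (_ *: _); ring.
Qed.

End abs_continuous_derivative.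

(** * Trajectories of the projected gradient field *)

Section projected_gradient.
Context (R : realType) (H : completeNormedModType R) (ip : {dot H for idfun}).
Hypothesis ip_norm : forall u : H, `|u| ^+ 2 = ip u u.
Context (Q : set H).
Hypotheses (Q_closed : closed Q) (Q_convex : convex_set Q) (Q_nonempty : Q !=set0).
Context (f : H -> R) (g : H -> H).
Hypotheses (f_grad : forall x y, f x + ip (g x) (y - x) <= f y)
  (g_cont : continuous g)
  (g_lip : [locally [lipschitz g x | x in [set: H]]]).
Context (mu : R -> R).
Hypotheses (mu_cont : continuous mu) (mu_gt0 : forall t, 0 < mu t).
Notation P := (metric_proj Q).

Definition proj_grad_field (t : R) (u : H) : H := P (u - mu t *: g u) - u.
Local Notation F := proj_grad_field.

Lemma proj_grad_field_continuous (s : R -> R) (y : R -> H) :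
  continuous s -> continuous y -> continuous (fun t => F (s t) (y t)).
Proof.
move=> sc yc t; apply: cvgB; last exact: yc.
apply: (@continuous_comp _ _ _ (fun t => y t - mu (s t) *: g (y t)) P); last first.
  exact: (metric_proj_continuous ip_norm).
apply: cvgB; first exact: yc.
apply: cvgZ.
  by apply: (@continuous_comp _ _ _ s mu); [exact: sc|exact: mu_cont].
by apply: (@continuous_comp _ _ _ y g); [exact: yc|exact: g_cont].
Qed.

(** Near [T] the step [mu] stays below [M] and the projection is nonexpansive, whence the constant 1
    + (1 + M L). The bound of the field goes from [u] to [x] by this constant, then from [t] to [T]
    at [x], where |mu t - mu T| < 1 costs at most |g x|. *)
Lemma proj_grad_field_lip : locally_lipschitz_field F.
Proof.
move=> T x; have [L [r [L0 r0 hg]]] := locally_lipschitzP g_lip x.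
have /cvgrPdist_lt/(_ _ ltr01)/nbhs_ballP[d /= d0 hd] := mu_cont (x := T).
pose M := mu T + 1; have M0 : 0 < M by rewrite addr_gt0.
pose r' := Num.min (r / 2) (d / 2).
have r'0 : 0 < r' by rewrite lt_min !divr_gt0.
have r'r : r' < r by rewrite gt_min; apply/orP; left; lra.
have r'd : r' < d by rewrite gt_min; apply/orP; right; lra.
have muM t : `|t - T| <= r' -> `|mu T - mu t| < 1.
  by move=> tT; apply: hd; rewrite -ball_normE /ball_ /= distrC (le_lt_trans tT).
have FL t u v : `|t - T| <= r' -> `|x - u| <= r' -> `|x - v| <= r' ->
    `|F t u - F t v| <= (2 + M * L) * `|u - v|.
  move=> tT xu xv; rewrite /F subBACA (le_trans (ler_normB _ _))//.
  have h1 := @metric_proj_nonexp _ _ _ ip_norm Q Q_closed Q_convex Q_nonempty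
    (u - mu t *: g u) (v - mu t *: g v).
  have h2 : `|u - mu t *: g u - (v - mu t *: g v)| <= `|u - v| + M * (L * `|u - v|).
    rewrite subBACA -scalerBr (le_trans (ler_normB _ _))// lerD2l normrZ.
    apply: ler_pM => //.
      by rewrite ger0_norm ?ltW//; have := muM t tT; rewrite /M ltr_norml; lra.
    by apply: hg; exact: le_lt_trans r'r.
  lra.
exists (2 + M * L), ((2 + M * L) * r' + (`|g x| + `|F T x|)), r'; split=> //.
  by rewrite addr_ge0// mulr_ge0// ltW.
have L1 : 0 <= 2 + M * L by rewrite addr_ge0// mulr_ge0// ltW.
move=> t tT; split=> [u v|u xu]; first exact: FL.
have xx : `|x - x| <= r' by rewrite subrr normr0 ltW.
rewrite -(subrK (F t x) (F t u)) (le_trans (ler_normD _ _))// lerD//.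
  apply: le_trans (FL _ _ _ tT xu xx) _.
  by rewrite ler_wpM2l// distrC.
rewrite -(subrK (F T x) (F t x)) (le_trans (ler_normD _ _))// lerD2r.
rewrite /F subBACA subrr subr0.
apply: le_trans (metric_proj_nonexp ip_norm Q_closed Q_convex Q_nonempty _ _) _.
rewrite subBACA subrr sub0r normrN -scalerBl normrZ distrC.
by rewrite ler_piMl// ltW// muM.
Qed.

(* [x' + x] lies in [Q], so the distance of [x] to [Q] is nonincreasing. *)
Lemma trajectory_in (b : R) (x : R -> H) :
  (forall t, 0 <= t <= b -> has_deriv_within `[0, b] x t (F t (x t))) ->
  Q (x 0) -> 0 <= b -> Q (x b).
Proof.
move=> hx x0Q b0; pose G t := `|x t - P (x t)|.
have distQ u q : Q q -> `|u - P u| <= `|u - q|.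
  by move=> Qq; have [_] := @metric_projP _ _ _ ip_norm Q Q_closed Q_convex Q_nonempty u; exact.
have PQ u : Q (P u) by exact: (metric_proj_in ip_norm).
suff : G b <= G 0.
  rewrite /G (metric_proj_id ip_norm Q_closed Q_convex Q_nonempty x0Q) subrr normr0.
  by rewrite normr_le0 subr_eq0 => /eqP ->.
apply: straddle_nonincreasing => // t e tb e0.
have [d d0 hd] := hx t tb e e0.
pose p := P (x t - mu t *: g (x t)).
have Qp : Q p by exact: PQ.
exists (Num.min d 1); first by rewrite lt_min d0 ltr01.
move=> s sb; rewrite lt_min => /andP[sd s1].
have := hd s; rewrite /= in_itv /= => /(_ sb sd).
rewrite /F -/p => h; split=> ts.
  have h0 : 0 <= s - t by rewrite subr_ge0.
  rewrite ger0_norm// in h s1.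
  (* Up to the remainder in [h], [x s] is the convex combination of [x t] and [p] with weight
     [s - t] on [p]; [q] is the same combination with [P (x t)] for [x t], a point of [Q]. *)
  pose q := (s - t) *: p + (1 - (s - t)) *: P (x t).
  have Qq : Q q by apply: convex_setP => //; rewrite //; lra.
  rewrite /G lerBlDr (le_trans (distQ (x s) q Qq))//.
  have -> : x s - q = (x s - x t - (s - t) *: (p - x t)) +
      (1 - (s - t)) *: (x t - P (x t)).
    by apply: (ip_injl ip_norm) => w; rewrite /q !(ipDl, ipNl, ipZl); ring.
  rewrite (le_trans (ler_normD _ _))// lerD// normrZ ger0_norm ?subr_ge0 ?(ltW s1)//.
  by rewrite ler_piMl//; lra.
have h0 : 0 <= t - s by rewrite subr_ge0.
rewrite (distrC s) (ger0_norm h0) in h s1.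
set r := x s - x t - (s - t) *: (p - x t) in h.
have k0 : 0 < 1 + (t - s) by lra.
have k0' : 1 + (t - s) != 0 by rewrite gt_eqF.
(* Backwards in time the Euler relation is solved for [x t], the combination of [x s - r] and [p]
   with weights [c] and [1 - c]; [q] has [P (x s)] in place of [x s - r]. *)
pose c := (1 + (t - s))^-1.
have c0 : 0 < c by rewrite invr_gt0.
have c1 : c <= 1 by rewrite invf_le1//; lra.
pose q := c *: P (x s) + (1 - c) *: p.
have Qq : Q q by apply: convex_setP => //; rewrite ?ltW.
rewrite /G lerBlDr (le_trans (distQ (x t) q Qq))//.
have -> : x t - q = c *: ((x s - P (x s)) - r).
  apply: (ip_injl ip_norm) => w; rewrite /q /r !(ipDl, ipNl, ipZl) /c.
  by field.
rewrite normrZ ger0_norm ?(ltW c0)// (@le_trans _ _ `|x s - P (x s) - r|)//.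
  by rewrite ler_piMl.
by rewrite (le_trans (ler_normB _ _))// [leLHS]addrC lerD2r.
Qed.

Lemma proj_grad_field_vi (t : R) (u z : H) : Q z ->
  0 <= ip (F t u + mu t *: g u) (z - (F t u + u)).
Proof.
move=> Qz.
have := @metric_proj_vi _ _ _ ip_norm Q Q_closed Q_convex Q_nonempty (u - mu t *: g u) z Qz.
rewrite /F subrK; set p := P _.
rewrite !(ipDl, ipDr, ipNl, ipNr, ipZl); lra.
Qed.

Lemma proj_grad_field_descent (t : R) (u : H) : Q u ->
  `|F t u| ^+ 2 <= - (mu t * ip (g u) (F t u)).
Proof.
move=> Qu; have := proj_grad_field_vi t u Qu; set v := F t u.
rewrite (_ : u - (v + u) = - v); last by rewrite opprD addrCA subrr addr0.
rewrite ip_norm !(ipDl, ipNr, ipZl); lra.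
Qed.

(** The expanded variational inequality contains <g u, u - z>, at least f u - f z by convexity, and
    |F t u|^2 with a favourable sign. Along a trajectory the middle term is [mu] times the
    derivative of [f o x]. *)
Lemma proj_grad_field_fejer (t : R) (u z : H) : Q z ->
  ip (F t u) (u - z) + mu t * ip (g u) (F t u) + mu t * (f u - f z) <= 0.
Proof.
move=> Qz; have := proj_grad_field_vi t u Qz; set v := F t u.
have := f_grad u z; have := mu_gt0 t; have := sqr_ge0 `|v|; rewrite ip_norm.
rewrite !(ipDl, ipDr, ipNl, ipNr, ipZl) => h1 h2 h3 h4.
have : mu t * (f u + (ip (g u) z + - ip (g u) u)) <= mu t * f z by rewrite ler_pM2l.
lra.
Qed.

Lemma has_deriv_within_small (D : set R) (x : R -> H) t v r : 0 < r ->
  has_deriv_within D x t v -> exists2 d : R, 0 < d & forall s, D s -> `|s - t| < d ->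
    `|x s - x t| <= (`|v| + 1) * `|s - t| /\ `|x s - x t| < r.
Proof.
move=> r0 hx; have [d d0 hd] := has_deriv_within_cvg hx r0.
have [d' d'0 hd'] := hx 1 ltr01.
exists (Num.min d d'); first by rewrite lt_min d0.
move=> s Ds; rewrite lt_min => /andP[sd sd']; split; last exact: hd.
have := hd' s Ds sd'; rewrite mul1r => h.
rewrite -(subrK ((s - t) *: v) (x s - x t)) (le_trans (ler_normD _ _))//.
rewrite normrZ; lra.
Qed.

(** The chain rule follows from the gradient inequality alone: at [x t] it bounds the increment of
    [f] from below, at [x s] from above, and continuity of [g] closes the gap. *)
Lemma has_deriv_within_f (D : set R) (x : R -> H) t v :
  has_deriv_within D x t v ->
  @has_deriv_within R R^o D (f \o x) t (ip (g (x t)) v).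
Proof.
move=> hx e e0; set gx := g (x t).
have C0 : 0 < 2 * (`|gx| + 1) by rewrite mulr_gt0// ltr_wpDl.
have V0 : 0 < 2 * (`|v| + 1) by rewrite mulr_gt0// ltr_wpDl.
have [d1 d10 hd1] := hx _ (divr_gt0 e0 C0).
have /cvgrPdist_lt/(_ _ (divr_gt0 e0 V0))/nbhs_ballP[r /= r0 hr] := g_cont (x := x t).
have [d2 d20 hd2] := has_deriv_within_small r0 hx.
exists (Num.min d1 d2); first by rewrite lt_min d10.
move=> s Ds; rewrite lt_min => /andP[sd1 sd2].
have h1 := hd1 s Ds sd1; have [h2 h3] := hd2 s Ds sd2.
have h4 : `|gx - g (x s)| < e / (2 * (`|v| + 1)).
  by apply: hr; rewrite -ball_normE /ball_ /= distrC.
have g1 := f_grad (x t) (x s); have g2 := f_grad (x s) (x t).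
set r1 := x s - x t - (s - t) *: v in h1.
have b1 : `|ip gx r1| <= e / 2 * `|s - t|.
  apply: le_trans (ip_cauchy_schwarz ip_norm _ _) _.
  apply: (@le_trans _ _ (`|gx| * (e / (2 * (`|gx| + 1)) * `|s - t|))).
    by rewrite ler_wpM2l.
  rewrite mulrA ler_wpM2r// mulrA ler_pdivrMr//.
  lra.
have b2 : `|ip (gx - g (x s)) (x s - x t)| <= e / 2 * `|s - t|.
  apply: le_trans (ip_cauchy_schwarz ip_norm _ _) _.
  apply: (@le_trans _ _ (e / (2 * (`|v| + 1)) * ((`|v| + 1) * `|s - t|))).
    by apply: ler_pM => //; exact: ltW.
  have k0 : 0 < `|v| + 1 by rewrite ltr_wpDl.
  rewrite le_eqVlt; apply/orP; left; apply/eqP.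
  by move: (`|v| + 1) (`|s - t|) k0 => k n k0; field; rewrite gt_eqF.
have e1 : ip gx (x s - x t) = ip gx r1 + (s - t) * ip gx v.
  by rewrite /r1 !(ipDr, ipNr, ipZr); ring.
have e2 : ip (g (x s)) (x t - x s) = ip (gx - g (x s)) (x s - x t) - ip gx (x s - x t).
  by rewrite !(ipDl, ipNl, ipDr, ipNr); ring.
move: b1 b2; rewrite !ler_norml => /andP[b11 b12] /andP[b21 b22].
rewrite -/gx e1 in g1; rewrite e2 e1 in g2.
by rewrite /GRing.scale /=; apply/andP; split; lra.
Qed.

Lemma has_deriv_within_dist2 (D : set R) (x : R -> H) t v z :
  has_deriv_within D x t v ->
  @has_deriv_within R R^o D (fun s => `|x s - z| ^+ 2 / 2) t (ip v (x t - z)).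
Proof.
move=> hx e e0.
have C0 : 0 < 2 * (`|x t - z| + 1) by rewrite mulr_gt0// ltr_wpDl.
have V0 : 0 < `|v| + 1 by rewrite ltr_wpDl.
have [d1 d10 hd1] := hx _ (divr_gt0 e0 C0).
have [d2 d20 hd2] := has_deriv_within_small (divr_gt0 e0 V0) hx.
exists (Num.min d1 d2); first by rewrite lt_min d10.
move=> s Ds; rewrite lt_min => /andP[sd1 sd2].
have h1 := hd1 s Ds sd1; have [h2 h3] := hd2 s Ds sd2.
set r1 := x s - x t - (s - t) *: v in h1.
have b1 : `|ip r1 (x t - z)| <= e / 2 * `|s - t|.
  apply: le_trans (ip_cauchy_schwarz ip_norm _ _) _.
  apply: (@le_trans _ _ (e / (2 * (`|x t - z| + 1)) * `|s - t| * `|x t - z|)).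
    by rewrite ler_wpM2r.
  rewrite mulrAC ler_wpM2r// mulrAC ler_pdivrMr//.
  lra.
have b2 : `|x s - x t| ^+ 2 <= e * `|s - t|.
  rewrite expr2; apply: (@le_trans _ _ (e / (`|v| + 1) * ((`|v| + 1) * `|s - t|))).
    by apply: ler_pM => //; exact: ltW.
  by rewrite mulrA divfK ?gt_eqF.
have e1 : `|x s - z| ^+ 2 / 2 - `|x t - z| ^+ 2 / 2 - (s - t) * ip v (x t - z) =
    ip r1 (x t - z) + `|x s - x t| ^+ 2 / 2.
  rewrite !ip_norm /r1 !(ipDl, ipDr, ipNl, ipNr, ipZl) (ipC ip z (x s)).
  rewrite (ipC ip z (x t)) (ipC ip (x t) (x s)).
  set c1 := ip (x s) (x s); set c2 := ip (x s) (x t); set c3 := ip (x t) (x t).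
  set c4 := ip (x s) z; set c5 := ip (x t) z; set c6 := ip z z.
  by field.
rewrite /GRing.scale /= e1 (le_trans (ler_normD _ _))//.
rewrite (ger0_norm (_ : 0 <= `|x s - x t| ^+ 2 / 2)) ?divr_ge0 ?sqr_ge0//; lra.
Qed.

Section trajectory.
Variables (x : R -> H) (b : R).
Hypotheses (hx : forall t, 0 <= t <= b -> has_deriv_within `[0, b] x t (F t (x t)))
  (x0Q : Q (x 0)).

Lemma trajectory_in_itv t : 0 <= t <= b -> Q (x t).
Proof.
move=> /andP[t0 tb]; apply: (@trajectory_in t) => // s /andP[s0 st].
apply: (has_deriv_withinS _ (hx _)); last by rewrite s0 (le_trans st).
by move=> r; rewrite /= !in_itv /= => /andP[-> rt] /=; exact: le_trans tb.
Qed.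

Let hx_itv p q t : 0 <= p -> q <= b -> p <= t <= q ->
  has_deriv_within `[p, q] x t (F t (x t)).
Proof.
move=> p0 qb /andP[pt tq].
apply: (has_deriv_withinS _ (hx _)); last by rewrite (le_trans p0) ?(le_trans tq).
move=> r; rewrite /= !in_itv /= => /andP[pr rq].
by rewrite (le_trans p0) ?(le_trans rq).
Qed.

(** The varying [mu] is replaced by its upper bound [M], which is legitimate because the derivative
    of [f o x] is nonpositive. The parameter [c] stays free, to be tuned to the length of the
    interval. *)
Lemma trajectory_speed p q c M : 0 <= p -> p <= q -> q <= b -> 0 < c ->
  (forall t, p <= t <= q -> mu t <= M) ->
  `|x q - x p| <= c / 2 * (q - p) + M / (2 * c) * (f (x p) - f (x q)).
Proof.
move=> p0 pq qb c0 hM.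
have hlin (k : R) (D : set R) (t : R) : @has_deriv_within R R^o D (fun s => s * k) t k.
  move=> e e0; exists 1 => // s _ _.
  by rewrite /GRing.scale /= -mulrBl subrr normr0 mulr_ge0// ltW.
have := @mean_value_dom R H p q x (fun t => F t (x t))
  (fun t => t * (c / 2) - (M / (2 * c)) * f (x t))
  (fun t => c / 2 - (M / (2 * c)) * ip (g (x t)) (F t (x t))) pq.
have -> : q * (c / 2) - M / (2 * c) * f (x q) - (p * (c / 2) - M / (2 * c) * f (x p)) =
  c / 2 * (q - p) + M / (2 * c) * (f (x p) - f (x q)) by ring.
apply => t tpq.
- exact: hx_itv.
- apply: (@has_deriv_withinB _ R^o); first exact: hlin.
  apply: (@has_deriv_withinZ _ R^o _ (f \o x)); apply: has_deriv_within_f.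
  exact: hx_itv.
have Qt : Q (x t).
  by apply: trajectory_in_itv; case/andP: tpq => pt tq; rewrite (le_trans p0) ?(le_trans tq).
have := proj_grad_field_descent t Qt; have := hM t tpq; have := mu_gt0 t.
set v := F t (x t); set k := ip _ v => mu0 muM h.
have k0 : k <= 0.
  have : 0 <= - (mu t * k) by apply: le_trans h; exact: sqr_ge0.
  by rewrite oppr_ge0 pmulr_rle0.
have h' : `|v| ^+ 2 <= - (M * k) by apply: le_trans h _; nra.
have -> : M / (2 * c) * k = (M * k) / (2 * c) by ring.
rewrite -subr_ge0.
have -> : c / 2 - M * k / (2 * c) - `|v| = ((c - `|v|) ^+ 2 + (- (M * k) - `|v| ^+ 2)) / (2 * c).
  by field; rewrite gt_eqF.
by rewrite divr_ge0 ?mulr_ge0 ?(ltW c0)// addr_ge0 ?sqr_ge0// subr_ge0.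
Qed.

Lemma trajectory_f_nonincreasing p q : 0 <= p -> p <= q -> q <= b -> f (x q) <= f (x p).
Proof.
move=> p0 pq qb.
(* Applied to the zero function dominated by the derivative of [- f o x], the mean value inequality
   becomes monotonicity. *)
have := @mean_value_dom R R^o p q (fun=> 0) (fun=> 0) (fun t => (-1) * f (x t))
  (fun t => (-1) * ip (g (x t)) (F t (x t))) pq.
rewrite subrr normr0 !mulN1r opprK addrC subr_ge0; apply => t tpq.
- exact: has_deriv_within_cst.
- apply: (@has_deriv_withinZ _ R^o _ (f \o x)); apply: has_deriv_within_f.
  exact: hx_itv.
have Qt : Q (x t).
  by apply: trajectory_in_itv; case/andP: tpq => pt tq; rewrite (le_trans p0) ?(le_trans tq).
have := proj_grad_field_descent t Qt => h.
have : 0 <= - (mu t * ip (g (x t)) (F t (x t))) by apply: le_trans h; exact: sqr_ge0.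
by rewrite mulN1r !oppr_ge0 pmulr_rle0.
Qed.

End trajectory.
End projected_gradient.

(** * Asymptotic behaviour *)

(** Compactness of [-M, M] gives a cluster point, and an ultrafilter converges to any of its cluster
    points. *)
Lemma ultra_bounded_cvg (R : realType) (T : Type) (U : set_system T)
    (UU : UltraFilter U) (u : T -> R) (M : R) :
  U [set t | `|u t| <= M] -> exists l : R, u t @[t --> U] --> l.
Proof.
move=> UM; have UM' : (u @ U) `[- M, M]%classic.
  change (U (u @^-1` `[- M, M]%classic)); apply: filterS UM => t /=.
  by rewrite in_itv /= ler_norml.
have [l [_ lc]] := segment_compact (fmap_proper_filter u ultra_proper) UM'.
exists l => B nB; have [//|UB] := in_ultra_setVsetC (u @^-1` B) UU.
by have [y [yB By]] := lc (~` B) B UB nB.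
Qed.

Lemma nonincreasing_cvgy (R : realType) (u : R -> R) (m : R) :
  (forall s t, 0 <= s -> s <= t -> u t <= u s) -> (forall t, 0 <= t -> m <= u t) ->
  exists l, u t @[t --> +oo] --> l /\ forall t, 0 <= t -> l <= u t.
Proof.
move=> und um; pose S : set R := [set u t | t in [set t | 0 <= t]].
have S0 : S !=set0 by exists (u 0), 0 => //=.
have Slb : has_lbound S by exists m => _ [t t0 <-]; exact: um.
have lu t : 0 <= t -> inf S <= u t by move=> t0; apply: ge_inf => //; exists t.
exists (inf S); split=> //; apply/cvgrPdist_lt => e e0.
have [_ [t0 /= t00 <-] ht0] := inf_adherent e0 (conj S0 Slb).
near=> t; have t0t : t0 <= t by near: t; apply: nbhs_pinfty_ge; exact: num_real.
have := lu t (le_trans t00 t0t); have := und t0 t t00 t0t => h1 h2.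
by rewrite distrC ger0_norm ?subr_ge0//; lra.
Unshelve. all: by end_near. Qed.

(** * Weak limits along ultrafilters *)

Section weak_limits.
Context (R : realType) (H : completeNormedModType R) (ip : {dot H for idfun}).
Hypothesis ip_norm : forall u : H, `|u| ^+ 2 = ip u u.
Context (T : Type).

(** Weak compactness of balls: the limits of the inner products form a bounded linear functional,
    whose Riesz representative is the weak limit. *)
Lemma weak_ultra_limit (U : set_system T) (UU : UltraFilter U) (x : T -> H) (M : R) :
  U [set t | `|x t| <= M] ->
  exists l, forall w, ip (x t) w @[t --> U] --> ip l w.
Proof.
move=> UM.
have ipb w t : `|x t| <= M -> `|ip (x t) w| <= M * `|w|.
  move=> xM; apply: le_trans (ip_cauchy_schwarz ip_norm _ _) _.
  by rewrite ler_wpM2r.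
have ex w : exists l : R, ip (x t) w @[t --> U] --> l.
  by apply: (@ultra_bounded_cvg _ _ _ _ _ (M * `|w|)); apply: filterS UM => t; exact: ipb.
have [phi hphi] := choice ex.
have [g hg] : exists g, forall w, phi w = ip g w.
  apply: (riesz ip_norm (C := M)).
    move=> a u w; apply: (@cvg_unique _ (@Rhausdorff R) (ip (x t) (a *: u + w) @[t --> U])).
      exact: hphi.
    have -> : (fun t => ip (x t) (a *: u + w)) = (fun t => a * ip (x t) u + ip (x t) w).
      by apply/funext => t; rewrite ipDr ipZr.
    by apply: cvgD; [apply: cvgM; [exact: cvg_cst|exact: hphi]|exact: hphi].
  move=> w; have c : `|ip (x t) w| @[t --> U] --> `|phi w|.
    exact: (cvg_norm (hphi w)).
  rewrite -(cvg_lim (@Rhausdorff R) c); apply: limr_le; first exact: cvgP c.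
  by apply: filterS UM => t; exact: ipb.
by exists g => w; rewrite -hg; exact: hphi.
Qed.

(* Opial's lemma, with ultrafilters in place of weakly convergent subsequences. *)
Lemma opial (F : set_system T) (FF : ProperFilter F) (x : T -> H) (S : set H) :
  S !=set0 ->
  (forall z, S z -> exists l : R, `|x t - z| ^+ 2 @[t --> F] --> l) ->
  (forall U l, UltraFilter U -> F `<=` U ->
    (forall w, ip (x t) w @[t --> U] --> ip l w) -> S l) ->
  exists2 xs, S xs & forall w, ip (x t) w @[t --> F] --> ip xs w.
Proof.
move=> [z0 Sz0] Scvg Sult.
have [M FM] : exists M, F [set t | `|x t| <= M].
  have [l hl] := Scvg z0 Sz0; exists (`|l| + 2 + `|z0|).
  have /cvgrPdist_lt/(_ _ ltr01) := hl; apply: filterS => t /= h.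
  rewrite -(subrK z0 (x t)) (le_trans (ler_normD _ _))// lerD2r.
  have h1 : `|x t - z0| ^+ 2 <= `|l| + 1.
    by move: h; rewrite ltr_norml; have := ler_norm l; lra.
  have := sqr_ge0 (`|x t - z0| - 1); have := normr_ge0 l; nra.
have ult U : UltraFilter U -> F `<=` U -> exists2 l, S l &
    forall w, ip (x t) w @[t --> U] --> ip l w.
  move=> UU FU; have [l hl] := weak_ultra_limit UU (FU _ FM).
  by exists l => //; exact: (Sult U).
(* The difference |x - l1|^2 - |x - l2|^2 is affine in [x], so <x t, l2 - l1> converges along [F]
   itself. Both ultrafilters see the same limit, so <l1, l2 - l1> = <l2, l2 - l1>. *)
have uniq U1 U2 l1 l2 : UltraFilter U1 -> UltraFilter U2 -> F `<=` U1 -> F `<=` U2 ->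
    S l1 -> S l2 -> (forall w, ip (x t) w @[t --> U1] --> ip l1 w) ->
    (forall w, ip (x t) w @[t --> U2] --> ip l2 w) -> l1 = l2.
  move=> UU1 UU2 FU1 FU2 S1 S2 h1 h2.
  have [m1 hm1] := Scvg l1 S1; have [m2 hm2] := Scvg l2 S2.
  pose m := (m1 - m2 - (`|l1| ^+ 2 - `|l2| ^+ 2)) * 2^-1.
  have hm : ip (x t) (l2 - l1) @[t --> F] --> m.
    have -> : (fun t => ip (x t) (l2 - l1)) =
       (fun t => (`|x t - l1| ^+ 2 - `|x t - l2| ^+ 2 - (`|l1| ^+ 2 - `|l2| ^+ 2)) * 2^-1).
      by apply/funext => t; rewrite !(normB2 ip_norm) ipBr; field.
    apply: cvgM; last exact: cvg_cst.
    by apply: cvgB; [exact: cvgB|exact: cvg_cst].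
  have e1 : ip l1 (l2 - l1) = m.
    apply: (@cvg_unique _ (@Rhausdorff R) (ip (x t) (l2 - l1) @[t --> U1])) => //=.
    by move=> B /hm; exact: FU1.
  have e2 : ip l2 (l2 - l1) = m.
    apply: (@cvg_unique _ (@Rhausdorff R) (ip (x t) (l2 - l1) @[t --> U2])) => //=.
    by move=> B /hm; exact: FU2.
  apply/esym/eqP; rewrite -subr_eq0 -normr_eq0 -sqrf_eq0 ip_norm ipBl e1 e2.
  by rewrite subrr.
have [U0 [UU0 FU0]] := ultraFilterLemma FF.
have [xs Sxs hxs] := ult U0 UU0 FU0.
exists xs => // w; apply/cvgrPdist_lt => e e0; apply: contrapT => nF.
(* If convergence failed, [F] would have a proper trace on [B]; an ultrafilter finer than this trace
   still converges weakly to [xs] by uniqueness, which [B] forbids. *)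
pose B := [set t | e <= `|ip xs w - ip (x t) w|].
have PB : ProperFilter (within B F).
  apply: Build_ProperFilter.
  move=> /= h; apply: nF; have {}h : F (fun t => B t -> False) by exact: h.
  apply: filterS h => t /= tB.
  by rewrite ltNge; apply/negP.
have [U [UU BU]] := ultraFilterLemma PB.
have FU : F `<=` U by move=> A FA; apply: BU; apply: filterS FA.
have [l Sl hl] := ult U UU FU.
have lxs : l = xs by exact: (uniq U U0).
have /cvgrPdist_lt/(_ _ e0) := hl w; rewrite lxs => UA.
have UB : U B by apply: BU; rewrite /within /=; exact: filterE.
have [t [/= t1]] := filter_ex (filterI UA UB).
by rewrite /B /= leNgt t1.
Qed.

End weak_limits.

(** * End limits, the Lyapunov function and weak convergence *)

Section asymptotics.
Context (R : realType) (H : completeNormedModType R) (ip : {dot H for idfun}).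
Hypothesis ip_norm : forall u : H, `|u| ^+ 2 = ip u u.
Context (Q : set H).
Hypotheses (Q_closed : closed Q) (Q_convex : convex_set Q) (Q_nonempty : Q !=set0).
Context (f : H -> R) (g : H -> H).
Hypotheses (f_grad : forall x y, f x + ip (g x) (y - x) <= f y)
  (g_cont : continuous g).
Context (mu : R -> R).
Hypotheses (mu_cont : continuous mu) (mu_gt0 : forall t, 0 < mu t).
Context (fQ : R).
Hypothesis f_ge : forall y, Q y -> fQ <= f y.
Notation P := (metric_proj Q).
Local Notation F := (proj_grad_field Q g mu).

Lemma trajectory_limit (b : R) (x : R -> H) : 0 < b -> Q (x 0) ->
  (forall t, 0 <= t < b -> has_deriv_within `[0, b[ x t (F t (x t))) ->
  exists l : H, x t @[t --> b^'-] --> l.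
Proof.
move=> b0 x0Q hx.
have hxq q : q < b -> forall t, 0 <= t <= q -> has_deriv_within `[0, q] x t (F t (x t)).
  move=> qb t /andP[t0 tq].
  apply: (has_deriv_withinS _ (hx _ _)); last by rewrite t0 (le_lt_trans tq).
  by move=> s; rewrite /= !in_itv /= => /andP[-> sq]; exact: le_lt_trans qb.
have xQ t : 0 <= t -> t < b -> Q (x t).
  move=> t0 tb.
  apply: (@trajectory_in_itv _ _ _ ip_norm Q Q_closed Q_convex Q_nonempty g mu x t) => //.
    exact: hxq.
  by rewrite t0 lexx.
have [m _ hm] := @EVT_max R mu 0 b (ltW b0) (continuous_subspaceT mu_cont).
have M0 : 0 < mu m by exact: mu_gt0.
set M := mu m in hm M0.
pose S : set R := [set f (x t) | t in [set t | 0 <= t < b]].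
have S0 : S !=set0 by exists (f (x 0)), 0 => //=; rewrite lexx.
have Slb : has_lbound S.
  by exists fQ => _ [t /= /andP[t0 tb] <-]; apply: f_ge; exact: xQ.
apply: cauchy_osc_cvg => e e0.
(* [c] spends half of [e] on the length of the interval, at most [b]; a decrease of [f] by [d]
   spends the other half, and [t0] is a time after which [f o x] loses less than [d]. *)
pose c := e / b; have c0 : 0 < c by rewrite divr_gt0.
pose d := e * c / M; have d0 : 0 < d by rewrite divr_gt0// mulr_gt0.
have [_ [t0 /= /andP[t00 t0b] <-] ht0] := inf_adherent d0 (conj S0 Slb).
exists [set t | t0 <= t < b].
  change (nbhs b (fun u => u < b -> t0 <= u < b)); apply/nbhs_ballP.
  exists (b - t0) => /=; first by rewrite subr_gt0.
  move=> t; rewrite -ball_normE /ball_ /= ltr_norml => /andP[h1 h2] tb.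
  by rewrite tb andbT; lra.
suff key p q : t0 <= p -> p <= q -> q < b -> `|x q - x p| <= e.
  move=> s t /= /andP[s0 sb] /andP[tt0 tb]; have [st|/ltW ts] := leP s t.
    by rewrite distrC key.
  by rewrite key.
move=> t0p pq qb.
have p0 := le_trans t00 t0p.
have sp := @trajectory_speed _ _ _ ip_norm Q Q_closed Q_convex Q_nonempty f g f_grad
  g_cont mu mu_gt0 x q (hxq q qb) x0Q p q c M p0 pq (lexx q) c0.
apply: (le_trans (sp _)).
  move=> t /andP[pt tq]; apply: hm; rewrite in_itv /= (le_trans p0 pt).
  by rewrite (ltW (le_lt_trans tq qb)).
have h1 : f (x p) <= f (x t0).
  have pb := le_lt_trans pq qb.
  exact: (@trajectory_f_nonincreasing _ _ _ ip_norm Q Q_closed Q_convex Q_nonempty f g f_grad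
    g_cont mu mu_gt0 x p (hxq p pb) x0Q t0 p).
have h2 : inf S <= f (x q).
  by apply: ge_inf => //; exists q => //=; rewrite qb (le_trans p0 pq).
have h3 : c / 2 * (q - p) <= e / 2.
  apply: (@le_trans _ _ (c / 2 * b)); first by rewrite ler_wpM2l ?divr_ge0 ?(ltW c0)//; lra.
  by rewrite mulrAC /c divfK ?gt_eqF.
have h4 : M / (2 * c) * (f (x p) - f (x q)) <= e / 2.
  apply: (@le_trans _ _ (M / (2 * c) * d)).
    have k0 : 0 <= M / (2 * c).
      by apply: divr_ge0; [exact: ltW|apply: mulr_ge0 => //; exact: ltW].
    by rewrite ler_wpM2l//; lra.
  rewrite le_eqVlt; apply/orP; left; apply/eqP; rewrite /d; field.
  by rewrite !gt_eqF.
lra.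
Qed.


Context (x : R -> H).
Hypotheses (hx : forall t, 0 <= t -> has_deriv_within `[0, +oo[ x t (F t (x t)))
  (x0Q : Q (x 0)).

Let hx_itv p q t : 0 <= p -> p <= t <= q -> has_deriv_within `[p, q] x t (F t (x t)).
Proof.
move=> p0 /andP[pt tq]; apply: (has_deriv_withinS _ (hx (le_trans p0 pt))).
by move=> s; rewrite /= !in_itv /= andbT => /andP[ps _]; exact: le_trans ps.
Qed.

Lemma global_trajectory_in t : 0 <= t -> Q (x t).
Proof.
move=> t0.
apply: (@trajectory_in_itv _ _ _ ip_norm Q Q_closed Q_convex Q_nonempty g mu x t) => //.
  by move=> s; exact: hx_itv.
by rewrite t0 lexx.
Qed.

Lemma global_f_nonincreasing p q : 0 <= p -> p <= q -> f (x q) <= f (x p).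
Proof.
move=> p0 pq.
apply: (@trajectory_f_nonincreasing _ _ _ ip_norm Q Q_closed Q_convex Q_nonempty f g f_grad
    g_cont mu mu_gt0 x q) => // t.
exact: hx_itv.
Qed.

Context (V Gam : R -> R) (C : R).
Hypotheses (muV : forall p q, 0 <= p -> p <= q -> `|mu q - mu p| <= V q - V p)
  (V0C : forall t, 0 <= t -> 0 <= V t <= C)
  (hGam : forall t, 0 <= t -> @has_deriv_within R R^o `[0, +oo[ Gam t (mu t))
  (Gam_ge0 : forall t, 0 <= t -> 0 <= Gam t)
  (Gam_unbounded : forall M, exists2 t, 0 <= t & M <= Gam t).

Let phi t := f (x t) - fQ.
Let W z t := `|x t - z| ^+ 2 / 2 + mu t * phi t - phi 0 * V t.

Let phi_ge0 t : 0 <= t -> 0 <= phi t.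
Proof. by move=> t0; rewrite subr_ge0 f_ge//; exact: global_trajectory_in. Qed.

Let phi_noninc p q : 0 <= p -> p <= q -> phi q <= phi p.
Proof. by move=> p0 pq; rewrite lerD2r; exact: global_f_nonincreasing. Qed.

(* [mu] is only continuous: its increments in [mu s * phi s - mu t * phi t] are
   absorbed by those of [phi 0 * V]. *)
Lemma lyapunov z p q : Q z -> f z = fQ -> 0 <= p -> p <= q ->
  (Gam q - Gam p) * phi q <= W z p - W z q.
Proof.
move=> Qz fz p0 pq.
(* With the final gap [c] frozen the claim is monotonicity of [G]; [c <= phi t] on [p, q] since
   [phi] is nonincreasing. *)
pose c := phi q.
pose G t := W z t + c * Gam t.
suff : G q <= G p by rewrite /G -/c; lra.
apply: straddle_nonincreasing => // t e /andP[pt tq] e0.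
have t0 := le_trans p0 pt.
have tpq : p <= t <= q by rewrite pt.
have hxt := hx_itv p0 tpq.
have hG : @has_deriv_within R R^o `[p, q] Gam t (mu t).
  apply: (has_deriv_withinS _ (hGam t0)) => s.
  by rewrite /= !in_itv /= andbT => /andP[ps _]; exact: le_trans ps.
(* The part of [G] that is differentiable at [t], with the coefficient of [f] frozen at [mu t]; the
   identity [GE] recovers [G] from it. *)
pose B s := `|x s - z| ^+ 2 / 2 - ((- mu t) * f (x s) - c * Gam s).
pose B' := ip (F t (x t)) (x t - z) - ((- mu t) * ip (g (x t)) (F t (x t)) - c * mu t).
have hB : @has_deriv_within R R^o `[p, q] B t B'.
  apply: (@has_deriv_withinB _ R^o); first exact: (has_deriv_within_dist2 ip_norm).
  apply: (@has_deriv_withinB _ R^o).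
    apply: (@has_deriv_withinZ _ R^o _ (f \o x)).
    exact: (has_deriv_within_f ip_norm).
  exact: (@has_deriv_withinZ _ R^o).
have B'0 : B' <= 0.
  have h := @proj_grad_field_fejer _ _ _ ip_norm Q Q_closed Q_convex Q_nonempty f g f_grad
    mu mu_gt0 t (x t) z Qz.
  rewrite fz in h.
  have : c * mu t <= mu t * (f (x t) - fQ).
    by rewrite mulrC ler_pM2l//; exact: phi_noninc.
  rewrite /B'; lra.
have [d d0 hd] := hB e e0; exists d => // s spq sd.
have := hd s; rewrite /= in_itv /= => /(_ spq sd).
have /andP[ps sq] := spq; have s0 := le_trans p0 ps.
have f1 := phi_ge0 s0; have f2 := phi_noninc (lexx 0) s0.
rewrite ler_norml /GRing.scale /= => /andP[h1 h2].
have GE : G s - G t = (B s - B t) + phi s * (mu s - mu t) - phi 0 * (V s - V t).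
  by rewrite /G /W /B /phi; ring.
split=> st.
  rewrite (ger0_norm (_ : 0 <= s - t)) ?subr_ge0// in h1 h2.
  have st0 : 0 <= s - t by rewrite subr_ge0.
  have b1 : phi s * (mu s - mu t) <= phi 0 * (V s - V t).
    apply: (@le_trans _ _ (phi s * `|mu s - mu t|)).
      by rewrite ler_wpM2l// ler_norm.
    by apply: ler_pM => //; exact: muV.
  rewrite GE; have : (s - t) * B' <= 0 by rewrite mulr_ge0_le0.
  lra.
rewrite (ler0_norm (_ : s - t <= 0)) ?subr_le0// in h1 h2.
have st0 : 0 <= t - s by rewrite subr_ge0.
have b1 : phi s * (mu t - mu s) <= phi 0 * (V t - V s).
  apply: (@le_trans _ _ (phi s * `|mu t - mu s|)).
    by rewrite ler_wpM2l// ler_norm.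
  by apply: ler_pM => //; exact: muV.
rewrite -[_ - G s]opprB GE; have : (t - s) * B' <= 0 by rewrite mulr_ge0_le0.
lra.
Qed.

Let Gam_nd p q : 0 <= p -> p <= q -> Gam p <= Gam q.
Proof.
move=> p0 pq; have := @mean_value_dom R R^o p q (fun=> 0) (fun=> 0) Gam mu pq.
rewrite subrr normr0 subr_ge0; apply => t /andP[pt tq].
- exact: has_deriv_within_cst.
- apply: (has_deriv_withinS _ (hGam (le_trans p0 pt))) => s.
  by rewrite /= !in_itv /= andbT => /andP[ps _]; exact: le_trans ps.
- exact: ltW.
Qed.

Let W_cvg z : Q z -> f z = fQ ->
  exists l : R, W z t @[t --> +oo] --> l /\ forall t, 0 <= t -> l <= W z t.
Proof.
move=> Qz fz; apply: (@nonincreasing_cvgy _ _ (- (phi 0 * C))).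
  move=> p q p0 pq; have := lyapunov Qz fz p0 pq.
  have : 0 <= (Gam q - Gam p) * phi q.
    apply: mulr_ge0; [by rewrite subr_ge0 Gam_nd|exact: phi_ge0 (le_trans p0 pq)].
  lra.
move=> t t0; have /andP[_ VC] := V0C t0.
have : phi 0 * V t <= phi 0 * C by rewrite ler_wpM2l ?phi_ge0.
have : 0 <= mu t * phi t by rewrite mulr_ge0 ?phi_ge0// ltW.
rewrite /W; have := sqr_ge0 `|x t - z|; lra.
Qed.

Context (z0 : H).
Hypotheses (Qz0 : Q z0) (fz0 : f z0 = fQ).

Lemma f_gap_small e : 0 < e -> exists2 t0, 0 <= t0 & forall t, t0 <= t -> phi t <= e.
Proof.
move=> e0; have [l [_ lW]] := W_cvg Qz0 fz0.
(* With k = (W z0 0 - l) / e, [Gam] has grown by at least [k + 1] after [t0]; a gap above [e] would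
   make [W] drop by more than [k * e], below its limit [l]. *)
have [t0 t00 ht0] := Gam_unbounded (Gam 0 + (W z0 0 - l) / e + 1).
exists t0 => // t tt0; rewrite leNgt; apply/negP => et.
have := lyapunov Qz0 fz0 (lexx 0) (le_trans t00 tt0).
have := lW t (le_trans t00 tt0).
have : Gam t0 <= Gam t by exact: Gam_nd.
have k0 : 0 <= (W z0 0 - l) / e by rewrite divr_ge0 ?(ltW e0)// subr_ge0 lW.
have : (W z0 0 - l) / e * e = W z0 0 - l by rewrite divfK ?gt_eqF.
move: ((W z0 0 - l) / e) k0 ht0 => k k0 ht0 h1 h2 h3 h4.
have : (k + 1) * phi t <= (Gam t - Gam 0) * phi t by rewrite ler_wpM2r ?phi_ge0 ?(le_trans t00)//; lra.
nra.
Qed.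

(** The product splits into [(Gam t - Gam p) * phi t], at most [W z0 p - l] and so small for a
    suitable fixed [p], and [Gam p * phi t], small for late [t]. *)
Lemma gap_rate : Gam t * phi t @[t --> +oo] --> (0 : R).
Proof.
apply/cvgrPdist_le => e e0; have [l [Wl lW]] := W_cvg Qz0 fz0.
have e2 : 0 < e / 2 by rewrite divr_gt0.
have [p p0 hp] : exists2 p, 0 <= p & W z0 p - l <= e / 2.
  have /cvgrPdist_le/(_ _ e2) := Wl.
  move=> /(filterI (nbhs_pinfty_ge (num_real 0)))/filter_ex[p [/= p0 hp]].
  by exists p => //; move: hp; rewrite ler_norml; lra.
have Gp1 : 0 < Gam p + 1 by rewrite ltr_wpDl// Gam_ge0.
have [t0 t00 ht0] := f_gap_small (divr_gt0 e2 Gp1).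
near=> t.
have pt : p <= t by near: t; apply: nbhs_pinfty_ge; exact: num_real.
have tt : t0 <= t by near: t; apply: nbhs_pinfty_ge; exact: num_real.
have t_ge0 := le_trans p0 pt.
have ph := phi_ge0 t_ge0.
have := ht0 t tt; rewrite ler_pdivlMr// => h1.
have := lyapunov Qz0 fz0 p0 pt; have := lW t t_ge0 => h2 h3.
rewrite sub0r normrN ger0_norm ?mulr_ge0 ?Gam_ge0//; lra.
Unshelve. all: by end_near. Qed.

Lemma f_gap_cvg : phi t @[t --> +oo] --> (0 : R).
Proof.
apply/cvgrPdist_le => e /f_gap_small[t0 t00 ht0]; near=> t.
have tt : t0 <= t by near: t; apply: nbhs_pinfty_ge; exact: num_real.
by rewrite sub0r normrN ger0_norm ?ht0// phi_ge0// (le_trans t00).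
Unshelve. all: by end_near. Qed.

(** [W] converges by monotonicity, [V] because it is nondecreasing and bounded, and [mu * phi]
    because [mu <= mu 0 + C] and the gap vanishes; the squared distance is a combination of the
    three. *)
Lemma dist2_cvg z : Q z -> f z = fQ -> exists l : R, `|x t - z| ^+ 2 @[t --> +oo] --> l.
Proof.
move=> Qz fz; have [l [Wl _]] := W_cvg Qz fz.
have [v [Vv _]] : exists v, - V t @[t --> +oo] --> v /\ forall t, 0 <= t -> v <= - V t.
  apply: (@nonincreasing_cvgy _ _ (- C)).
    move=> p q p0 pq; rewrite lerN2.
    by rewrite -subr_ge0 (le_trans _ (muV p0 pq)).
  by move=> t /V0C /andP[_]; rewrite lerN2.
have mphi : mu t * phi t @[t --> +oo] --> (0 : R).
  have B0 : 0 <= mu 0 + C.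
    by rewrite addr_ge0 ?(ltW (mu_gt0 0))//; have /andP[] := V0C (lexx 0); exact: le_trans.
  have : (mu 0 + C) * phi t @[t --> +oo] --> (mu 0 + C) * 0.
    by apply: cvgM; [exact: cvg_cst|exact: f_gap_cvg].
  rewrite mulr0; apply: squeeze_cvgr (cvg_cst 0); near=> t.
  have t0 : 0 <= t by near: t; apply: nbhs_pinfty_ge; exact: num_real.
  rewrite mulr_ge0 ?phi_ge0 ?(ltW (mu_gt0 t))//= ler_wpM2r ?phi_ge0//.
  have := le_trans (ler_norm _) (muV (lexx 0) t0).
  by have /andP[? ?] := V0C t0; have /andP[? ?] := V0C (lexx 0); lra.
exists (2 * (l - 0 - phi 0 * v)).
have -> : (fun t => `|x t - z| ^+ 2) =
    (fun t => 2 * (W z t - mu t * phi t - phi 0 * - V t)).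
  by apply/funext => t; rewrite /W; field.
apply: cvgM; first exact: cvg_cst.
by apply: cvgB; [exact: cvgB|apply: cvgM => //; exact: cvg_cst].
Unshelve. all: by end_near. Qed.

Lemma trajectory_weak_cvg : exists xs, [/\ Q xs, f xs = fQ &
  forall w, ip (x t) w @[t --> +oo] --> ip xs w].
Proof.
have [|||xs [Qxs fxs] hxs] := @opial _ _ _ ip_norm R (+oo : set_system R) _ x
  [set z | Q z /\ f z = fQ]; last by exists xs.
- by exists z0.
- by move=> z [Qz fz]; exact: dist2_cvg.
move=> U l UU FU hl.
have Ux : U [set t | 0 <= t] by apply: FU; apply: nbhs_pinfty_ge; exact: num_real.
(* A closed convex set is weakly closed: the variational inequality for the projection of [l],
   tested with [x t], passes to the limit and gives |l - p|^2 <= 0. *)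
have Ql : Q l.
  pose p := P l.
  have : ip (l - p) (l - p) <= 0.
    have c : ip (x t) (l - p) - ip p (l - p) @[t --> U] --> ip l (l - p) - ip p (l - p).
      by apply: cvgB; [exact: hl|exact: cvg_cst].
    rewrite ipBl -(cvg_lim (@Rhausdorff R) c); apply: limr_le; first exact: cvgP c.
    apply: filterS Ux => t /= t0; rewrite -ipBl ipC.
    by apply: (metric_proj_vi ip_norm Q_closed Q_convex Q_nonempty); exact: global_trajectory_in.
  rewrite -ip_norm => h.
  have : l - p = 0.
    by apply/eqP; rewrite -normr_eq0 -sqrf_eq0 eq_le h sqr_ge0.
  by move/eqP; rewrite subr_eq0 => /eqP ->; exact: (metric_proj_in ip_norm).
split=> //; apply/eqP; rewrite eq_le f_ge// andbT.
(* Weak lower semicontinuity through the affine minorant of [f] at [l]: the subtracted linear term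
   tends to 0 along [U], and what remains is at least [f l - fQ]. *)
have c : phi t - (ip (x t) (g l) - ip l (g l)) @[t --> U] --> 0 - (ip l (g l) - ip l (g l)).
  apply: cvgB; last by apply: cvgB; [exact: hl|exact: cvg_cst].
  by move=> B /f_gap_cvg; exact: FU.
rewrite !subrr in c.
rewrite -subr_le0 -(cvg_lim (@Rhausdorff R) c); apply: limr_ge; first exact: cvgP c.
apply: nearW => t; rewrite /phi.
have := f_grad l (x t); rewrite ipBr (ipC ip (x t)) (ipC ip l); lra.
Qed.

End asymptotics.

(** * Well-posedness and convergence *)

Section derive_within_lemmas.
Context (R : realType) (V : normedModType R).
Implicit Types (D : set R) (x : R -> V) (t : R).

Lemma has_deriv_within_quot D x t v : has_deriv_within D x t v ->
  derive_quot x t s @[s --> within D t^'] --> v.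
Proof.
move=> h; apply/cvgrPdist_le => e e0; have [d d0 hd] := h e e0.
change (nbhs t (fun s => s != t -> D s -> `|v - derive_quot x t s| <= e)).
apply/nbhs_ballP; exists d => //= s; rewrite -ball_normE /ball_ /= distrC.
move=> sd st Ds; have := hd s Ds sd; have st0 : 0 < `|s - t| by rewrite normr_gt0 subr_eq0.
have -> : x s - x t - (s - t) *: v = (s - t) *: (derive_quot x t s - v).
  by rewrite scalerBr /derive_quot scalerA divff ?scale1r// subr_eq0.
by rewrite normrZ mulrC ler_pM2r// distrC.
Qed.

Lemma derivable_within_has_deriv D x t : derivable_within D x t ->
  has_deriv_within D x t (derive_within D x t).
Proof.
move=> h e e0; have /cvgrPdist_le/(_ _ e0) : derive_quot x t s @[s --> within D t^'] -->
  derive_within D x t by [].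
move=> hq; have /nbhs_ballP[d /= d0 hd] :
  nbhs t (fun s => s != t -> D s -> `|derive_within D x t - derive_quot x t s| <= e) by [].
exists d => // s Ds sd; have [->|st] := eqVneq s t.
  by rewrite !subrr scale0r subrr !normr0 mulr0.
have st0 : 0 < `|s - t| by rewrite normr_gt0 subr_eq0.
have -> : x s - x t - (s - t) *: derive_within D x t =
    (s - t) *: (derive_quot x t s - derive_within D x t).
  by rewrite scalerBr /derive_quot scalerA divff ?scale1r// subr_eq0.
rewrite normrZ mulrC ler_pM2r// distrC; apply: hd => //.
by rewrite -ball_normE /ball_ /= distrC.
Qed.

Lemma has_deriv_within_derive x t v : 0 <= t ->
  has_deriv_within `[0, +oo[ x t v -> derive_within `[0, +oo[ x t = v.
Proof.
move=> t0 /has_deriv_within_quot h; apply: cvg_lim => //.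
apply: Build_ProperFilter.
change (~ nbhs t (fun s => s != t -> `[0, +oo[%classic s -> False)).
move=> /nbhs_ballP[d /= d0 hd]; apply: (hd (t + d / 2)).
- rewrite -ball_normE /ball_ /= opprD addrA subrr sub0r normrN gtr0_norm ?divr_gt0//; lra.
- by rewrite -subr_eq0 addrAC subrr add0r gt_eqF// divr_gt0.
- by rewrite /= in_itv /= andbT; lra.
Qed.

End derive_within_lemmas.

Lemma integral_unbounded (R : realType) (h : R -> R) : continuous h ->
  (forall t, 0 <= t -> 0 <= h t) ->
  (\int[lebesgue_measure]_(t in `[0%R, +oo[) (h t)%:E = +oo)%E ->
  forall M, exists2 t, 0 <= t & M <= \int[lebesgue_measure]_(s in `[0, t]) h s.
Proof.
move=> hc h0 hoo M.
have := @ge0_nondecreasing_set_cvg_integral _ _ _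
  (fun n => `[0, 0 + n%:R]%classic : set (measurableTypeR R)) (EFin \o h)
  (@lebesgue_measure R).
rewrite -itv_bndy_bigcup_BRight hoo => cv.
have {}cv : (\int[lebesgue_measure]_(x in `[0%R, (0 + n%:R)%R]) (h x)%:E)%E @[n --> \oo] --> +oo%E.
  apply: cv.
  - move=> m n mn; apply/subsetPset; apply: subset_itvl.
    by rewrite bnd_simp lerD2l ler_nat.
  - by move=> n; exact: measurable_itv.
  - move=> n; apply: measurable_int.
    exact: (continuous_itv_integrable hc).
  - by move=> n x /=; rewrite in_itv /= lee_fin => /andP[/h0].
have /cvgeyPge/(_ M)/filter_ex[n hn] := cv.
exists (0 + n%:R); first by rewrite add0r.
rewrite -lee_fin /Rintegral fineK//.
apply: integrable_fin_num => //; exact: (continuous_itv_integrable hc).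
Qed.

Lemma abs_continuous_max_continuous (R : realType) (h : R -> R) :
  (forall T, 0 <= T -> abs_continuous 0 T h) ->
  continuous (fun t : R => h (Num.max 0 t)).
Proof.
move=> hac t; apply/cvgrPdist_lt => e e0.
have T0 : 0 <= Num.max 0 t + 1 by rewrite addr_ge0// le_max lexx.
have [d d0 hd] := abs_continuous_dist (hac _ T0) e0.
have mc : {for t, continuous (fun s : R => Num.max 0 s)}.
  by apply: (@continuous_max R R (fun=> 0) id); [exact: cvg_cst|exact: cvg_id].
near=> s; apply: hd.
- by rewrite le_max lexx /= lerDl.
- rewrite le_max lexx /=.
  have : `|Num.max 0 t - Num.max 0 s| < 1 by near: s; exact: cvgr_dist_lt.
  by rewrite ltr_norml; lra.
- by near: s; exact: cvgr_dist_lt.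
Unshelve. all: by end_near. Qed.

Theorem theorem1p1 (R : realType) (H : completeNormedModType R)
    (ip : {dot H for idfun}) (ip_norm : forall u : H, `|u| ^+ 2 = ip u u)
    (Q : set H) (Q_closed : closed Q) (Q_convex : convex_set Q)
    (Q_nonempty : Q !=set0)
    (lambda : R -> R) (lambda_gt0 : forall t : R, 0 <= t -> 0 < lambda t)
    (lambda_ac : forall T : R, 0 <= T -> abs_continuous 0 T lambda)
    (f : H -> R) (f_diff : forall x, differentiable f x)
    (f_C1 : continuous (gradient ip f))
    (f_convex : convex_function [set: H] f)
    (f_locLip : [locally [lipschitz gradient ip f x | x in [set: H]]])
    (fQ : R) (fQ_min : is_minimum [set f y | y in Q] fQ)
    (x0 : H) (x0Q : Q x0) :
  exists x : R -> H,
    [/\ proj_grad_solution ip Q f lambda x0 x,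
        forall t : R, 0 <= t -> Q (x t),
        forall y, proj_grad_solution ip Q f lambda x0 y ->
          forall t : R, 0 <= t -> y t = x t &
        (\int[lebesgue_measure]_(t in `[0%R, +oo[) (lambda t)%:E = +oo)%E ->
        (\int[lebesgue_measure]_(t in `[0%R, +oo[) `|derive1 lambda t|%:E < +oo)%E ->
        (exists xs : H, [/\ Q xs, f xs = fQ & weak_cvg (+oo : set_system R) x xs]) /\
        (\int[lebesgue_measure]_(s in `[0, t]) lambda s) * (f (x t) - fQ)
          @[t --> +oo] --> (0 : R)].
Proof.
(* The field is extended to negative times by [lambda 0]. *)
pose mu t := lambda (Num.max 0 t).
have muE t : 0 <= t -> mu t = lambda t by move=> t0; rewrite /mu (max_idPr t0).
have mu_cont : continuous mu by exact: abs_continuous_max_continuous.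
have mu_gt0 t : 0 < mu t by apply: lambda_gt0; rewrite le_max lexx.
have f_grad := gradient_ineq ip_norm f_diff f_convex.
pose F := proj_grad_field Q (gradient ip f) mu.
have Flip : locally_lipschitz_field F by exact: (proj_grad_field_lip ip_norm).
have f_ge y : Q y -> fQ <= f y by move=> Qy; apply: fQ_min.2; exists y.
have [x xx0 hx] : exists2 x : R -> H, x 0 = x0 & forall t, 0 <= t ->
    has_deriv_within `[0, +oo[ x t (F t (x t)).
  apply: (global_existence ip_norm) => //.
    by move=> s y sc yc; exact: (proj_grad_field_continuous ip_norm).
  move=> b x b0 xx0; apply: (trajectory_limit ip_norm Q_closed Q_convex Q_nonempty
    f_grad f_C1 mu_cont mu_gt0 f_ge b0).
  by rewrite xx0.
have xQ t : 0 <= t -> Q (x t).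
  by apply: (global_trajectory_in ip_norm Q_closed Q_convex Q_nonempty hx); rewrite xx0.
exists x; split=> //.
- split=> //; last first.
    move=> t t0; rewrite (has_deriv_within_derive t0 (hx t t0)) /F /proj_grad_field.
    by rewrite subrK muE.
  split=> [t|].
    rewrite /= in_itv /= andbT => t0.
    exact: cvgP (has_deriv_within_quot (hx t t0)).
  apply: (@subspace_eq_continuous _ _ _ (fun t => F t (x (Num.max 0 t)))).
    move=> t; rewrite inE /= in_itv /= andbT => t0.
    by rewrite (max_idPr t0); apply/esym; exact: has_deriv_within_derive t0 (hx t t0).
  apply: continuous_subspaceT.
  apply: (@proj_grad_field_continuous _ _ _ ip_norm Q Q_closed Q_convex Q_nonempty
    (gradient ip f) f_C1 mu mu_cont id).
    by move=> t; exact: cvg_id.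
  exact: (continuous_deriv_max hx).
- move=> y [[yd _] ye y0] t t0.
  (* Uniqueness holds among all solutions of the equation, because the field is locally Lipschitz on
     the whole space and not only on [Q]. *)
  have hy s : 0 <= s -> has_deriv_within `[0, +oo[ y s (F s (y s)).
    move=> s0; rewrite /F /proj_grad_field muE// -ye// addrK.
    by apply: derivable_within_has_deriv; apply: yd; rewrite /= in_itv /= s0.
  have S : `[0, t] `<=` `[0, +oo[%classic.
    by move=> s; rewrite /= !in_itv /= andbT => /andP[].
  apply: (@ode_unique _ _ F Flip 0 t); rewrite ?y0 ?xx0 ?t0 ?lexx//.
    by move=> s /andP[s0 _]; exact: (has_deriv_withinS S (hy s s0)).
  by move=> s /andP[s0 _]; exact: (has_deriv_withinS S (hx s s0)).
move=> lam_oo dlam_lty.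
pose V t := fine (total_variation 0 t lambda).
pose Gam t := \int[lebesgue_measure]_(s in `[0, t]) lambda s.
pose C := fine (\int[lebesgue_measure]_(t in `[0%R, +oo[) `|derive1 lambda t|%:E)%E.
have TVfin p q : 0 <= p -> p <= q -> total_variation p q lambda \is a fin_num.
  move=> p0 pq; apply/bounded_variationP => //.
  apply: (bounded_variationr p0 pq).
  by apply: abs_continuous_BV; [exact: le_trans pq|apply: lambda_ac; exact: le_trans pq].
have muV p q : 0 <= p -> p <= q -> `|mu q - mu p| <= V q - V p.
  move=> p0 pq; have q0 := le_trans p0 pq.
  rewrite !muE// /V (total_variationD lambda p0 pq) fineD ?TVfin//.
  rewrite addrAC subrr add0r -lee_fin fineK ?TVfin//.
  exact: total_variation_ge.
(* The integral over the entire half-line bounds the variation on every [0, t], and its finiteness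
   makes [C] a real bound. *)
have V0C t : 0 <= t -> 0 <= V t <= C.
  move=> t0; rewrite fine_ge0 ?total_variation_ge0//=.
  apply: fine_le; first exact: TVfin.
    by rewrite ge0_fin_numE// integral_ge0.
  apply: abs_continuous_TV_le => //; last exact: lambda_ac.
  by move=> s; rewrite /= !in_itv /= andbT => /andP[].
have GamE t : Gam t = \int[lebesgue_measure]_(s in `[0, t]) mu s.
  apply: eq_Rintegral => s; rewrite inE /= in_itv /= => /andP[s0 _].
  by rewrite muE.
have hGam t : 0 <= t -> @has_deriv_within R R^o `[0, +oo[ Gam t (mu t).
  move=> t0; have -> : Gam = fun t => \int[lebesgue_measure]_(s in `[0, t]) mu s.
    by apply/funext.
  exact: Rintegral_has_deriv.
have Gam_ge0 t : 0 <= t -> 0 <= Gam t.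
  by move=> t0; rewrite GamE; apply: Rintegral_ge0 => s _; exact: ltW.
have Gam_oo M : exists2 t, 0 <= t & M <= Gam t.
  have [|t t0 Mt] := @integral_unbounded R mu mu_cont (fun t _ => ltW (mu_gt0 t)) _ M.
    rewrite -lam_oo; apply: eq_integral => s; rewrite inE /= in_itv /= andbT => s0.
    by rewrite muE.
  by exists t => //; rewrite GamE.
have [[z0 Qz0 fz0] _] := fQ_min.
have x0Q' : Q (x 0) by rewrite xx0.
split.
  have [xs [Qxs fxs hxs]] := @trajectory_weak_cvg _ _ _ ip_norm Q Q_closed Q_convex
    Q_nonempty f (gradient ip f) f_grad f_C1 mu mu_gt0 fQ f_ge x hx x0Q' V Gam C
    muV V0C hGam Gam_oo z0 Qz0 fz0.
  (* [weak_cvg] quantifies over continuous linear functionals; Riesz turns each into an inner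
     product. *)
  exists xs; split=> // phi phic.
  have [k k0 hk] := linear_lipschitz phic.
  have [|a ha] := riesz ip_norm _ hk; first by move=> c u v; rewrite linearP.
  rewrite ha ipC; have -> : (fun t => phi (x t)) = fun t => ip (x t) a.
    by apply/funext => t; rewrite ha ipC.
  exact: hxs.
exact: (@gap_rate _ _ _ ip_norm Q Q_closed Q_convex
    Q_nonempty f (gradient ip f) f_grad f_C1 mu mu_gt0 fQ f_ge x hx x0Q' V Gam C
    muV V0C hGam Gam_ge0 Gam_oo z0 Qz0 fz0).
Qed.
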